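(* Let $f\colon X\to[-\infty,+\infty]$ be a densely defined lower semicontinuous functional and $N<0$. Then $$\mathcal R_1\big(\mathbb{EVI}_{0,N}(f)\big)=\mathbb{EVI}_0(f_N)\cap\mathcal C''_N\qquad\text{and}\qquad\mathcal R_2\big(\mathbb{EVI}_0(f_N)\cap\mathcal C''_N\big)=\mathbb{EVI}_{0,N}(f).$$ In particular, $\mathcal R_1$ restricted to $\mathbb{EVI}_{0,N}(f)$ is a bijection onto $\mathbb{EVI}_0(f_N)\cap\mathcal C''_N$, and $\mathcal R_2$ restricted to $\mathbb{EVI}_0(f_N)\cap\mathcal C''_N$ is a bijection onto $\mathbb{EVI}_{0,N}(f)$.
   Context: Setting. $(X,d)$ is a metric space, not necessarily complete, which is strictly intrinsic (any two points are joined by a geodesic in $X$) and whose metric completion is geodesic (complete and strictly intrinsic). A geodesic is a continuous curve $\gamma\colon[0,1]\to X$ with $d(\gamma_s,\gamma_t)=|t-s|\,d(\gamma_0,\gamma_1)$. For $g\colon X\to[-\infty,+\infty]$: $\mathcal D[g]=\{g\ne\pm\infty\}$ and $\mathcal D^\star[g]=\{g<+\infty\}$; ''densely defined'' means that $\mathcal D[f]$ is dense in $X$; $\mathcal D[f]\ne\emptyset$. $f_N:=e^{-f/N}$, with $f_N=0$ where $f=-\infty$ and $f_N=+\infty$ where $f=+\infty$; thus $\mathcal D[f_N]=\mathcal D^\star[f]$. $\frac{\mathrm d^+}{\mathrm dt}h(t):=\limsup_{\epsilon\downarrow0}\frac{h(t+\epsilon)-h(t)}{\epsilon}$. $\mathbb{EVI}_{0,N}(f)$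 is the set of all $\mathrm{EVI}_{0,N}$ gradient curves for $f$, i.e. continuous curves $(y_t)_{t\in(0,T)}\subset\mathcal D[f]$, $T\in(0,+\infty]$, with $$\frac{\mathrm d^+}{\mathrm dt}\Big[\Big(\frac{d(y_t,z)}2\Big)^2\Big]\le\frac N2\Big(1-\frac{f_N(z)}{f_N(y_t)}\Big)\qquad\text{for every }z\in\mathcal D^\star[f],\ t\in(0,T).$$ $\mathbb{EVI}_0(f_N)$ is the set of all $\mathrm{EVI}_0$ gradient curves for $f_N$ contained in $\mathcal D[f]$, i.e. continuous curves $(z_s)_{s\in(0,T')}\subset\mathcal D[f]$, $T'\in(0,+\infty]$, with $\frac{\mathrm d^+}{\mathrm ds}\frac{d(z_s,z)^2}2\le f_N(z)-f_N(z_s)$ for every $z\in\mathcal D[f_N]$, $s\in(0,T')$. Reparametrization maps. $\mathcal C'$ is the set of continuous curves $(y_t)_{t\in(0,T)}$ with values in $\mathcal D[f]$, $T\in(0,+\infty]$, such that $t\mapsto f(y_t)$ is non-increasing on $(0,T)$; $\mathcal C''_N$ is the set of $(y_t)_{t\in(0,T)}\in\mathcal C'$ with $\int_0^{T\wedge1}f_N(y_t)\,\mathrm dt<\infty$. Both $\mathbb{EVI}_{0,N}(f)$ and $\mathbb{EVI}_0(f_N)$ are contained in $\mathcal C'$. $\mathcal R_1\colon\mathcal C'\to\mathcal C''_N$: given $(y_t)_{t\in(0,T)}$, let $\alpha(t)=-N\int_0^t\frac1{f_N(y_r)}\,\mathrm dr$, $T'=\lim_{t\to T^-}\alpha(t)$,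 $\varphi=\alpha^{-1}\colon(0,T')\to(0,T)$, and $\mathcal R_1((y_t)_{t\in(0,T)})=(y_{\varphi(s)})_{s\in(0,T')}$. $\mathcal R_2\colon\mathcal C''_N\to\mathcal C'$: given $(z_s)_{s\in(0,T')}$, let $\beta(s)=-\frac1N\int_0^sf_N(z_r)\,\mathrm dr$, $T=\lim_{s\to T'^-}\beta(s)$, $\psi=\beta^{-1}\colon(0,T)\to(0,T')$, and $\mathcal R_2((z_s)_{s\in(0,T')})=(z_{\psi(t)})_{t\in(0,T)}$. *)

(* Defs.v *)
From HB Require Import structures.
From mathcomp Require Import all_boot all_order all_algebra.
From mathcomp Require Import all_classical all_reals all_analysis.

Set Implicit Arguments.
Unset Strict Implicit.
Unset Printing Implicit Defensive.

Import Order.TTheory GRing.Theory Num.Theory.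
Import numFieldNormedType.Exports.

Local Open Scope classical_set_scope.
Local Open Scope ring_scope.

Section geodesics.
Context {R : realType}.
Implicit Types X Y : metricType R.

(* Only the values of [g] on [0, 1] are relevant. *)
Definition is_geodesic X (g : R -> X) : Prop :=
  {within `[0, 1], continuous g} /\
  {in `[0, 1] &, forall s t : R,
    mdist (g s) (g t) = `|t - s| * mdist (g 0) (g 1)}.

Definition strictly_intrinsic X : Prop :=
  forall x y : X, exists g : R -> X, [/\ is_geodesic g, g 0 = x & g 1 = y].

(* The library's [completeType] is pointed by definition, hence not used. *)
Definition complete_space X : Prop :=
  forall F : set_system X, ProperFilter F -> cauchy F -> exists l : X, F --> l.

Definition is_completion X Y (i : X -> Y) : Prop :=
  [/\ complete_space Y,
      forall x x' : X, mdist (i x) (i x') = mdist x x'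
    & dense (range i)].

Definition geodesic_completion X : Prop :=
  exists (Y : metricType R) (i : X -> Y), is_completion i /\ strictly_intrinsic Y.

End geodesics.

Section functionals.
Context {R : realType} {T : Type}.
Local Open Scope ereal_scope.
Implicit Types g f : T -> \bar R.

Definition edom g : set T := [set x | g x \is a fin_num].

Definition edom_star g : set T := [set x | g x < +oo].

(* For N < 0 the factor - 1 / N is positive, so that the conventions of
   [mule] and [expeR] give 0 where f = -oo and +oo where f = +oo; see the
   lemmas below. *)
Definition expN (N : R) f : T -> \bar R :=
  fun x => expeR ((- N^-1)%R%:E * f x).

Lemma expN_fin (N : R) f x r : f x = r%:E ->
  expN N f x = (expR (- r / N))%:E.
Proof. by rewrite /expN => -> /=; rewrite mulNr mulrC mulNr. Qed.

Lemma expN_Ny (N : R) f x : (N < 0)%R -> f x = -oo -> expN N f x = 0.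
Proof. by rewrite /expN => N0 ->; rewrite gt0_muleNy// lte_fin oppr_gt0 invr_lt0. Qed.

Lemma expN_y (N : R) f x : (N < 0)%R -> f x = +oo -> expN N f x = +oo.
Proof. by rewrite /expN => N0 ->; rewrite gt0_muley// lte_fin oppr_gt0 invr_lt0. Qed.

Lemma edom_expN (N : R) f : (N < 0)%R -> edom (expN N f) = edom_star f.
Proof.
move=> N0; apply/seteqP; split => x; rewrite /edom /edom_star /=.
  by case E : (f x) => [r||] //; rewrite ?ltry// (expN_y N0 E).
by case E : (f x) => [r||] // _; rewrite ?(expN_fin N E)// (expN_Ny N0 E).
Qed.

End functionals.

(* Upper right Dini derivative. *)
Definition dini_upper_right {R : realType} (h : R -> R) (t : R) : \bar R :=
  limf_esup (fun e : R => ((h (t + e) - h t) / e)%:E) 0^'+.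

(* The open interval ]0, T[ for T in \bar R. *)
Definition itv0 {R : realType} (T : \bar R) : set R :=
  [set t : R | 0 < t /\ (t%:E < T)%E].

(* The filter of t --> T^-, with t real and T possibly infinite. *)
Definition left_nbhs {R : realType} (T : \bar R) : set_system R :=
  match T with
  | r%:E => r^'-
  | +oo%E => pinfty_nbhs R
  | -oo%E => ninfty_nbhs R
  end.

(* A curve is a function whose domain is the (sub)type of the elements of
   ]0, T[, so that equality of curves is equality of T and of the values on
   ]0, T[.  That T is positive is required in [curve_in]. *)
Record curve (R : realType) (X : Type) := Curve {
  dur : \bar R ;
  path_of :> set_type (itv0 dur) -> X
}.
Arguments Curve {R X} dur path_of.

Section curves.
Context {R : realType} {X : metricType R}.
Local Open Scope ereal_scope.
Implicit Types (f g : X -> \bar R) (y z : curve R X) (N : R).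

Definition curve_in (A : set X) : set (curve R X) := [set y |
  [/\ 0 < dur y, continuous (y : itv0 (dur y) -> X)
    & forall t, A (y t)]].

(* [along u y] is t |-> u (y t), extended by 0 outside of ]0, T[. *)
Definition along (V : nmodType) (u : X -> V) y : R -> V :=
  'valL_ 0%R (fun t : itv0 (dur y) => u (y t)).

Definition EVI_0N N f : set (curve R X) := [set y |
  curve_in (edom f) y /\
  forall (x : X) (t : itv0 (dur y)), edom_star f x ->
    dini_upper_right (along (fun p => ((mdist p x / 2) ^+ 2)%R) y) (\val t)
      <= (N / 2)%R%:E * (1 - expN N f x / expN N f (y t))].

(* EVI_0 gradient curves for g contained in A. *)
Definition EVI_0 g (A : set X) : set (curve R X) := [set z |
  curve_in A z /\
  forall (x : X) (s : itv0 (dur z)), edom g x ->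
    dini_upper_right (along (fun p => (mdist p x ^+ 2 / 2)%R) z) (\val s)
      <= g x - g (z s)].

Definition C1 f : set (curve R X) := [set y |
  curve_in (edom f) y /\
  forall s t : itv0 (dur y), (\val s <= \val t)%R -> f (y t) <= f (y s)].

Definition C2 N f : set (curve R X) := [set y |
  C1 f y /\
  \int[lebesgue_measure]_(t in itv0 (mine (dur y) 1)) along (expN N f) y t
    < +oo].

(* [reparam a y] is the curve y \o a^-1 on ]0, lim_(t -> T^-) a(t)[.  When a
   does not attain all values of this interval on ]0, T[, it is (arbitrarily)
   defined as y; for the clocks below this does not occur on [C1], resp.
   [C2]. *)
Definition reparam (a : R -> \bar R) y : curve R X :=
  let T' := lim (a t @[t --> left_nbhs (dur y)]) in
  match pselect (forall s : itv0 T', exists t : itv0 (dur y),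
                   a (\val t) = (\val s)%:E) with
  | left a_onto => Curve T' (fun s => y (projT1 (cid (a_onto s))))
  | right _ => y
  end.

Definition clock1 N f y (t : R) : \bar R :=
  (- N)%R%:E *
    \int[lebesgue_measure]_(r in `]0%R, t[) along (fun p => (expN N f p)^-1) y r.

Definition R1 N f y : curve R X := reparam (clock1 N f y) y.

Definition clock2 N f z (s : R) : \bar R :=
  (- N^-1)%R%:E *
    \int[lebesgue_measure]_(r in `]0%R, s[) along (expN N f) z r.

Definition R2 N f z : curve R X := reparam (clock2 N f z) z.

End curves.

(* Main.v *)
(* The energy f is non-increasing along an EVI_{0,N} curve: if f (y_s) < f (y_t)
   with s < t, test the inequality with the last position before t whose energy
   is at most f (y_s); the curve does not move away from it, hence is still there
   at time t.  As f is lower semicontinuous, f o y is therefore also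
   right-continuous, so that the clock alpha is strictly increasing and
   continuous, with the right derivative - N / f_N (y_t), and its inverse has the
   right derivative f_N (z_s) / (- N), i.e. it is the clock beta of z = R_1 y.
   The chain rule for the upper right Dini derivative under such a change of time
   turns either EVI into the other one. *)

Require Import Defs.
From HB Require Import structures.
From mathcomp Require Import all_boot all_order all_algebra.
From mathcomp Require Import all_classical all_reals all_analysis.
From mathcomp Require Import measurable_realfun ring lra.
Set Implicit Arguments.
Unset Strict Implicit.
Unset Printing Implicit Defensive.

Import Order.TTheory GRing.Theory Num.Theory.
Import numFieldNormedType.Exports.
Local Open Scope classical_set_scope.
Local Open Scope ring_scope.

(** * Upper right Dini derivatives *)

(** The energy may jump down along a curve, so the clocks are in general only right differentiable,
    and f_N may blow up at time 0. Integrals are therefore handled without derivatives: of a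
    monotone rate k and its primitive, only the bounds on the increments over [a, b] by (b - a)
    times the end values of k are kept. They make sense on an open interval and pass to the inverse
    function by division, so that one relation between y and z, symmetric up to inverting the rate,
    serves both maps and both implications. The algebra behind the exchange of the two EVI: for v =
    - N / f_N (y_t), twice the bound of EVI_{0,N} is N + f_N (x) v = v (f_N (x) - f_N (y_t)), that
    is, v times the bound of EVI_0. The asymmetry between C' and C''_N comes from time 0: along a
    curve of C' the rate - N / f_N is non-decreasing, hence bounded near 0, while its inverse is
    non-increasing and may fail to be integrable there. *)

Section dini.
Context {R : realType}.
Implicit Types (h : R -> R) (a b c t : R).

(** Replaces the limsup in [\bar R] by linear bounds on real increments, with a slack [eps] into
    which later errors are absorbed. *)
Lemma dini_upper_right_leP h t c :
  (dini_upper_right h t <= c%:E)%E <->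
  forall eps, 0 < eps ->
    \forall e \near 0^'+, h (t + e) - h t <= (c + eps) * e.
Proof.
split=> [hc eps eps0|hc].
  have : (dini_upper_right h t < (c + eps)%:E)%E.
    by rewrite (le_lt_trans hc)// lte_fin ltrDl.
  move=> /ereal_inf_lt[_ [V V0 <-]] Vc.
  near=> e; have e0 : 0 < e by [].
  rewrite -ler_pdivrMr// -lee_fin (le_trans _ (ltW Vc))//.
  apply: ereal_sup_ubound; exists e => //; near: e; exact: V0.
apply/lee_addgt0Pr => eps /hc{}hc.
pose V := [set e : R | 0 < e /\ h (t + e) - h t <= (c + eps) * e].
apply: (@le_trans _ _ (ereal_sup [set ((h (t + e) - h t) / e)%:E | e in V])).
  apply: ereal_inf_lbound; exists V => //.
  by near=> e; split => //; near: e; exact: hc.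
apply: ge_ereal_sup => _ [e [e0 he] <-].
by rewrite -EFinD lee_fin ler_pdivrMr.
Unshelve. all: by end_near. Qed.

Lemma dini_upper_rightZ h t a c : 0 < a ->
  (dini_upper_right h t <= c%:E)%E ->
  (dini_upper_right (fun r => (a * h r)%R) t <= (a * c)%:E)%E.
Proof.
move=> a0 /dini_upper_right_leP hc; apply/dini_upper_right_leP => eps eps0.
have /hc := divr_gt0 eps0 a0; apply: filterS => e.
rewrite -mulrBr -(ler_pM2l a0) => /le_trans; apply.
by rewrite mulrA mulrDr [a * (_ / _)]mulrC divfK// gt_eqF.
Qed.

(** Tilt h by the slope [- eps]. A minimum of the tilted function at some c < b is impossible, since
    just after c it decreases with slope at most [- eps / 2]; the minimum is thus at b. *)
Lemma dini_upper_right_le0_noninc h a b : a <= b ->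
  {within `[a, b], continuous h} ->
  (forall t, a <= t < b -> (dini_upper_right h t <= 0)%E) -> h b <= h a.
Proof.
move=> ab hcont hd; apply/ler_addgt0Pr => eps0 eps0_gt0.
have [eps eps_gt0 epsE] : exists2 eps, 0 < eps & eps * (b - a) <= eps0.
  (* The [+ 1] covers the case a = b. *)
  exists (eps0 / (b - a + 1)); first by rewrite divr_gt0// ltr_wpDl// subr_ge0.
  rewrite mulrAC ler_pdivrMr ?ltr_wpDl ?subr_ge0// ler_pM2l//.
  by rewrite lerDl.
rewrite -lerBlDr (le_trans (lerB (lexx _) epsE))//.
pose g t := h t - eps * (t - a).
suff : g b <= g a by rewrite /g subrr mulr0 subr0.
have gcont : {within `[a, b], continuous g}.
  move=> t; apply: cvgB; first exact: hcont.
  apply: cvgMr; apply: cvgB; last exact: cvg_cst.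
  by apply: continuous_subspaceT => ?; exact: cvg_id.
have [c] := EVT_min ab gcont; rewrite in_itv/= => /andP[ac].
rewrite le_eqVlt => /predU1P[->|cb] gmin.
  by apply: gmin; rewrite in_itv/= lexx ab.
have /hd/dini_upper_right_leP : a <= c < b by rewrite ac.
move=> /(_ _ (divr_gt0 eps_gt0 (ltr0Sn R 1))).
rewrite add0r => hc; exfalso.
near (0 : R)^'+ => e.
have e0 : 0 < e by [].
have : g c <= g (c + e).
  apply: gmin; rewrite in_itv/= (le_trans ac) ?lerDl ?(ltW e0)//=.
  rewrite -lerBrDl; near: e; apply: nbhs_right_le.
  by rewrite subr_gt0.
rewrite /g -lerBlDr; apply/negP; rewrite -ltNge.
have he : h (c + e) - h c <= eps / 2 * e by near: e; exact: hc.
have := mulr_gt0 eps_gt0 e0.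
move: he; rewrite !mulrBr !mulrDr; nra.
Unshelve. all: by end_near. Qed.

(** As B increases strictly to the right of s, [B (s + e) - B s] is a positive increment tending to
    0, so it can be inserted in the linear bound for h at [B s]. The sign of c is arbitrary, which
    is why a genuine limit k of the quotients of B is required. *)
Lemma dini_upper_right_chain h h' (B : R -> R) s k c :
  h' s = h (B s) ->
  (\forall e \near 0^'+, h' (s + e) = h (B (s + e))) ->
  (\forall e \near 0^'+, B s < B (s + e)) ->
  (B (s + e) - B s) / e @[e --> 0^'+] --> k -> 0 <= k ->
  (dini_upper_right h (B s) <= c%:E)%E ->
  (dini_upper_right h' s <= (k * c)%:E)%E.
Proof.
move=> hs hse Blt Bk k0 /dini_upper_right_leP hc.
apply/dini_upper_right_leP => eps eps0.
have B0 : B (s + e) - B s @[e --> 0^'+] --> 0^'+.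
  have cB : B (s + e) - B s @[e --> 0^'+] --> (0 : R).
    have : (B (s + e) - B s) / e * e @[e --> 0^'+] --> k * 0.
      apply: cvgM => //; exact: cvg_within.
    rewrite mulr0; apply: cvg_trans; apply: near_eq_cvg.
    by near=> e; rewrite divfK// gt_eqF.
  move=> P /= P0; have /cB : nbhs (0:R) [set e | 0 < e -> P e] by exact: P0.
  rewrite !near_simpl => cP; near=> e.
  have : 0 < B (s + e) - B s -> P (B (s + e) - B s) by near: e.
  by apply; rewrite subr_gt0; near: e.
(* Chosen so that d * k < eps; the [+ 1] keeps the denominator positive when k = 0. *)
pose d := eps / (2 * (k + 1)).
have k1 : 0 < k + 1 by rewrite ltr_wpDl.
have d0 : 0 < d by rewrite divr_gt0// mulr_gt0.
have {}hc := B0 _ (hc d d0).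
have kd : (c + d) * k < k * c + eps.
  rewrite mulrDl [k * c]mulrC ltrD2l /d mulrAC ltr_pdivrMr ?mulr_gt0//.
  by rewrite ltr_pM2l//; lra.
have Bke : (c + d) * ((B (s + e) - B s) / e) @[e --> 0^'+] --> (c + d) * k.
  exact: cvgMr.
near=> e; have e0 : 0 < e by [].
have -> : h' (s + e) = h (B (s + e)) by near: e.
rewrite hs.
have : h (B s + (B (s + e) - B s)) - h (B s) <= (c + d) * (B (s + e) - B s).
  by near: e; exact: hc.
rewrite subrKC => /le_trans; apply.
rewrite -ler_pdivrMr// -mulrA ltW//; near: e.
exact: (cvgr_lt _ Bke).
Unshelve. all: by end_near. Qed.

End dini.

(** * Primitives of monotone functions *)

Section itv0.
Context {R : realType}.
Implicit Types (T : \bar R) (s t : R).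

Lemma itv0_le T s t : itv0 T t -> 0 < s -> s <= t -> itv0 T s.
Proof. by move=> [_ tT] s0 st; split=> //; rewrite (le_lt_trans _ tT). Qed.

Lemma is_interval_itv0 T : is_interval (itv0 T).
Proof.
move=> s t [s0 _] tT u /andP[su ut].
exact: itv0_le tT (lt_le_trans s0 su) ut.
Qed.

Lemma open_itv0 T : open (itv0 T).
Proof.
apply: openI; first exact: open_gt.
case: T => [r||].
- rewrite [X in open X](_ : _ = [set t | t < r]); first exact: open_lt.
  by apply/seteqP; split => x /=; rewrite lte_fin.
- rewrite [X in open X](_ : _ = setT); first exact: openT.
  by apply/seteqP; split => // x _ /=; exact: ltry.
- rewrite [X in open X](_ : _ = set0); first exact: open0.
  by apply/seteqP; split => // x /=; rewrite ltNge leNye.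
Qed.

Lemma measurable_itv0 T : measurable (itv0 T).
Proof. by apply: is_interval_measurable; exact: is_interval_itv0. Qed.

Lemma itv0_nonempty T : (0 < T)%E -> itv0 T !=set0.
Proof.
case: T => [r|_|//]; last by exists 1; split => //; exact: ltry.
rewrite lte_fin => r0; exists (r / 2); split; first by rewrite divr_gt0.
by rewrite lte_fin; lra.
Qed.

Lemma itv0_next T t : itv0 T t -> exists2 t', t < t' & itv0 T t'.
Proof.
case: T => [r||] [t0]; last by rewrite ltNge leNye.
  rewrite lte_fin => tr; exists ((t + r) / 2); first lra.
  by split; [lra|rewrite lte_fin; lra].
by move=> _; exists (t + 1); [lra|split; [lra|exact: ltry]].
Qed.

Lemma ereal_sup_itv0 T : (0 < T)%E -> ereal_sup (EFin @` itv0 T) = T.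
Proof.
move=> T0; apply/eqP; rewrite eq_le; apply/andP; split.
  by apply: ge_ereal_sup => _ [t [_ /ltW tT] <-].
rewrite leNgt; apply/negP => sT.
have [t tT] := itv0_nonempty T0.
have st : (t%:E <= ereal_sup (EFin @` itv0 T))%E.
  by apply: ereal_sup_ubound; exists t.
have [r rE] : exists r, ereal_sup (EFin @` itv0 T) = r%:E.
  move: st sT; case: ereal_sup => [r||]; [by exists r| |by rewrite leeNy_eq].
  by move=> _; rewrite ltNge leey.
move: st sT; rewrite rE lee_fin => tr rT.
have rT0 : itv0 T r by split => //; apply: lt_le_trans tr; case: tT.
have [t' rt' t'T] := itv0_next rT0.
have : (t'%:E <= ereal_sup (EFin @` itv0 T))%E.
  by apply: ereal_sup_ubound; exists t'.
by rewrite rE lee_fin leNgt rt'.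
Qed.

End itv0.

Section bracketed.
Context {R : realType}.
Implicit Types (D E : set R) (k A B : R -> R) (a b t : R) (T : \bar R).

Definition monotone_on D k :=
  (forall a b, D a -> D b -> a <= b -> k a <= k b) \/
  (forall a b, D a -> D b -> a <= b -> k b <= k a).

(* For monotone [k], this says that [A] is a primitive of [k]: it determines [A]
   up to a constant.  Unlike a condition on derivatives, it is visibly stable
   under replacing [A] by its inverse function and [k] by [1 / (k \o A^-1)]. *)
Definition bracketed D k A := forall a b, D a -> D b -> a <= b ->
  (b - a) * Num.min (k a) (k b) <= A b - A a <= (b - a) * Num.max (k a) (k b).

(* The increments of [A - B] over [a, b] are at most [(b - a) * |k b - k a|];
   halving the interval divides this bound by 2. *)
Lemma bracketed_uniq D k A B a b : is_interval D -> monotone_on D k ->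
  bracketed D k A -> bracketed D k B ->
  D a -> D b -> a <= b -> A b - A a = B b - B a.
Proof.
move=> iD mk bA bB.
pose E r := A r - B r.
have E_le u v : D u -> D v -> u <= v -> `|E v - E u| <= (v - u) * `|k v - k u|.
  move=> Du Dv uv; have := bA _ _ Du Dv uv; have := bB _ _ Du Dv uv.
  have -> : `|k v - k u| = Num.max (k u) (k v) - Num.min (k u) (k v).
    case: (leP (k u) (k v)) => [kk|/ltW kk].
      by rewrite ger0_norm// subr_ge0.
    by rewrite ler0_norm ?subr_le0// opprB.
  by move=> /andP[h1 h2] /andP[h3 h4]; rewrite ler_norml mulrBr /E; lra.
have E_le_expn n u v : D u -> D v -> u <= v ->
    `|E v - E u| <= (v - u) * `|k v - k u| / 2 ^+ n.
  elim: n u v => [|n ih] u v Du Dv uv; first by rewrite expr0 divr1; exact: E_le.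
  pose w := (u + v) / 2.
  have uw : u <= w by rewrite /w; lra.
  have wv : w <= v by rewrite /w; lra.
  have Dw : D w by apply: (iD _ _ Du Dv); rewrite uw wv.
  have k_add : `|k v - k w| + `|k w - k u| = `|k v - k u|.
    case: mk => mk; have := mk _ _ Du Dw uw; have := mk _ _ Dw Dv wv.
      by move=> kwv kuw; rewrite !ger0_norm; lra.
    by move=> kwv kuw; rewrite !ler0_norm; lra.
  rewrite (_ : E v - E u = (E v - E w) + (E w - E u)); last by ring.
  rewrite (le_trans (ler_normD _ _))//.
  rewrite (le_trans (lerD (ih _ _ Dw Dv wv) (ih _ _ Du Dw uw)))//.
  rewrite (_ : v - w = (v - u) / 2); last by rewrite /w; field.
  rewrite (_ : w - u = (v - u) / 2); last by rewrite /w; field.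
  rewrite le_eqVlt; apply/orP; left; apply/eqP.
  by rewrite -k_add exprS; field; rewrite expf_neq0.
move=> Da Db ab; apply/eqP; rewrite -subr_eq0.
rewrite (_ : _ - _ = E b - E a); last by rewrite /E; ring.
rewrite -normr_le0; apply/ler_addgt0Pr => eps eps0; rewrite add0r.
pose C := (b - a) * `|k b - k a|.
have C0 : 0 <= C by rewrite mulr_ge0// subr_ge0.
have [n Cn] : exists n, C / eps < n%:R.
  by exists (Num.trunc (C / eps)).+1; exact: truncnS_gt.
apply: (le_trans (E_le_expn n _ _ Da Db ab)).
rewrite ler_pdivrMr ?exprn_gt0// -ler_pdivrMl// mulrC (le_trans (ltW Cn))//.
by rewrite -natrX ler_nat ltnW// ltn_expl.
Qed.

(** The superlevel sets of a monotone function on an interval are intervals. *)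
Lemma monotone_measurable D E k : is_interval D -> monotone_on D k ->
  E `<=` D -> measurable_fun E k.
Proof.
move=> iD mk ED; apply: (measurable_funS _ ED); first exact: is_interval_measurable.
apply: (measurability (@RGenCInfty.G R)) => [|/= _ [_] [r] -> <-].
  exact: RGenCInfty.measurableE.
apply: is_interval_measurable => s t/=.
rewrite !in_itv/= !andbT => -[Ds rs] [Dt rt] u sut.
have Du := iD _ _ Ds Dt u sut; split => //; rewrite in_itv/= andbT.
move: sut => /andP[su ut].
by case: mk => mk; [apply: le_trans (mk s u _ _ _)|apply: le_trans (mk u t _ _ _)].
Qed.

Local Notation mu := (@lebesgue_measure R).

Lemma integral_itv_bracket D k a b : is_interval D -> monotone_on D k ->
  (forall x, D x -> 0 <= k x) -> D a -> D b -> a <= b ->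
  (((b - a) * Num.min (k a) (k b))%:E <= \int[mu]_(x in `[a, b[) (k x)%:E
   <= ((b - a) * Num.max (k a) (k b))%:E)%E.
Proof.
move=> iD mk k0 Da Db ab.
have abD : `[a, b[ `<=` D.
  move=> x /=; rewrite in_itv/= => /andP[ax /ltW xb].
  by apply: (iD _ _ Da Db); rewrite ax.
have mkab : measurable_fun `[a, b[ (EFin \o k).
  by apply/measurable_EFinP; exact: monotone_measurable abD.
have cstE c : ((b - a) * c)%:E = (\int[mu]_(x in `[a, b[) c%:E)%E.
  rewrite integral_cst//= lebesgue_measure_itv/= lte_fin.
  case: ltP => [_|ba]; first by rewrite -EFinB -EFinM mulrC.
  by rewrite mule0 (@le_anti _ _ a b) ?ab// subrr mul0r.
rewrite !cstE; apply/andP; split; apply: ge0_le_integral => //=.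
- by move=> x _; rewrite lee_fin le_min !k0.
- move=> x abx; have Dx := abD x abx; move: abx; rewrite in_itv/= => /andP[ax /ltW xb].
  by rewrite lee_fin ge_min; case: mk => mk; [rewrite (mk a x)|rewrite (mk x b) ?orbT].
- by move=> x /abD/k0; rewrite lee_fin.
- move=> x abx; have Dx := abD x abx; move: abx; rewrite in_itv/= => /andP[ax /ltW xb].
  by rewrite lee_fin le_max; case: mk => mk; [rewrite (mk x b) ?orbT|rewrite (mk a x)].
Qed.

End bracketed.

Section bracketed_integral.
Context {R : realType}.
Implicit Types (D : set R) (k A : R -> R) (a b t : R) (T : \bar R).
Local Notation mu := (@lebesgue_measure R).

Lemma integral_itv_fin D k a b : is_interval D -> monotone_on D k ->
  (forall x, D x -> 0 <= k x) -> D a -> D b -> a <= b ->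
  (\int[mu]_(x in `[a, b[) (k x)%:E)%E \is a fin_num.
Proof.
move=> iD mk k0 Da Db ab.
have /andP[+ +] := integral_itv_bracket iD mk k0 Da Db ab.
by case: (integral _ _ _).
Qed.

Lemma ge0_integral_itv_catl (I : itv_bound R) k a b :
  (I <= BLeft a)%O -> a <= b ->
  measurable_fun [set` Interval I (BLeft b)] k ->
  (forall x, x \in Interval I (BLeft b) -> 0 <= k x) ->
  (\int[mu]_(x in [set` Interval I (BLeft b)]) (k x)%:E =
   \int[mu]_(x in [set` Interval I (BLeft a)]) (k x)%:E +
   \int[mu]_(x in `[a, b[) (k x)%:E)%E.
Proof.
move=> Ia ab mk k0.
have abE : [set` Interval I (BLeft b)] =
    [set` Interval I (BLeft a)] `|` `[a, b[%classic :> set R.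
  by rewrite -itv_bndbnd_setU// bnd_simp.
have mkE : measurable_fun [set` Interval I (BLeft b)] (EFin \o k).
  exact/measurable_EFinP.
have k0E x : [set` Interval I (BLeft b)] x -> (0 <= (EFin \o k) x)%E.
  by move=> /k0; rewrite lee_fin.
rewrite abE in mkE k0E *; rewrite ge0_integral_setU//.
apply/disj_setPS => x [] /=; rewrite !itv_boundlr => /andP[_ xa] /andP[ax _].
by move: xa ax; rewrite !bnd_simp => xa; rewrite leNgt xa.
Qed.

Lemma integral_bracketed D k a : is_interval D -> monotone_on D k ->
  (forall x, D x -> 0 <= k x) -> D a ->
  bracketed [set x | D x /\ a <= x] k
    (fun r => fine (\int[mu]_(x in `[a, r[) (k x)%:E)%E).
Proof.
move=> iD mk k0 Da b c [Db ab] [Dc ac] bc.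
have acD : `[a, c[ `<=` D.
  move=> x /=; rewrite in_itv/= => /andP[ax /ltW xc].
  by apply: (iD _ _ Da Dc); rewrite ax.
rewrite (@ge0_integral_itv_catl (BLeft a) k b c)//; last 2 first.
  exact: monotone_measurable acD.
  by move=> x /acD /k0.
have ab_fin := integral_itv_fin iD mk k0 Da Db ab.
have bc_fin := integral_itv_fin iD mk k0 Db Dc bc.
rewrite fineD// addrAC subrr add0r -!lee_fin fineK//.
exact: integral_itv_bracket iD mk k0 Db Dc bc.
Qed.

(** Monotone convergence along the exhaustion of ]0, t[ by intervals that stay away from 0, where k
    may be unbounded. *)
Lemma cvg_integral_itv0 T k t : monotone_on (itv0 T) k ->
  (forall x, itv0 T x -> 0 <= k x) -> itv0 T t ->
  (\int[mu]_(x in `[(t / n.+2%:R)%R, t[) (k x)%:E @[n --> \oo] -->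
   \int[mu]_(x in `]0%R, t[) (k x)%:E)%E.
Proof.
move=> mk k0 Tt; have [t0 _] := Tt.
have sub_itv0 n : `[t / n.+2%:R, t[%classic `<=` itv0 T.
  move=> x /=; rewrite in_itv/= => /andP[tx /ltW xt].
  by apply: itv0_le Tt _ xt; rewrite (lt_le_trans _ tx)// divr_gt0.
have -> : `]0, t[%classic = \bigcup_n `[t / n.+2%:R, t[%classic :> set R.
  apply/seteqP; split => x /=.
    rewrite in_itv/= => /andP[x0 xt].
    exists (Num.trunc (t / x)) => //=; rewrite in_itv/= xt andbT.
    rewrite ler_pdivrMr// -ler_pdivrMl// mulrC ltW//.
    by rewrite (lt_le_trans (truncnS_gt _))// ler_nat.
  move=> [n _ /=]; rewrite !in_itv/= => /andP[tx ->]; rewrite andbT.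
  by rewrite (lt_le_trans _ tx)// divr_gt0.
apply: ge0_nondecreasing_set_cvg_integral => //.
- move=> n m nm; apply/subsetPset => x /=; rewrite !in_itv/= => /andP[+ ->].
  rewrite andbT; apply: le_trans.
  by rewrite ler_pM2l// lef_pV2 ?posrE// ler_nat.
- by move=> n; apply/measurable_EFinP; exact: (monotone_measurable (@is_interval_itv0 _ T) mk).
- by move=> n x /sub_itv0/k0; rewrite lee_fin.
Qed.

(** On [t / (n + 2), t] both A and the integral from the left endpoint are bracketed by k, so
    [bracketed_uniq] equates their increments; the limit at 0 of A then fixes the additive
    constant. *)
Lemma integral_bracketed_eq T k A t : monotone_on (itv0 T) k ->
  (forall x, itv0 T x -> 0 <= k x) -> bracketed (itv0 T) k A ->
  A a @[a --> 0^'+] --> (0 : R) -> itv0 T t ->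
  (\int[mu]_(x in `]0%R, t[) (k x)%:E = (A t)%:E)%E.
Proof.
move=> mk k0 bA A0 Tt; have [t0 _] := Tt.
have iT := @is_interval_itv0 _ T.
have atn n : t / n.+2%:R <= t.
  by rewrite ler_pdivrMr// ler_peMr ?(ltW t0)// ler1n.
have aT n : itv0 T (t / n.+2%:R) by apply: itv0_le Tt _ (atn n); rewrite divr_gt0.
have intE n : (\int[mu]_(x in `[(t / n.+2%:R)%R, t[) (k x)%:E =
    (A t - A (t / n.+2%:R))%:E)%E.
  have bJ := integral_bracketed iT mk k0 (aT n).
  set D := [set x | _] in bJ.
  have iD : is_interval D.
    move=> x y [Tx ax] [Ty ay] z /andP[xz zy]; split; last exact: le_trans xz.
    by apply: (iT _ _ Tx Ty); rewrite xz.
  have mD : monotone_on D k.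
    by case: mk => mk; [left|right] => x y [Tx _] [Ty _]; exact: mk.
  have bD : bracketed D k A by move=> x y [Tx _] [Ty _]; exact: bA.
  have := bracketed_uniq iD mD bJ bD _ _ (atn n).
  rewrite /D/= => /(_ (conj (aT n) (lexx _)) (conj Tt (atn n))) <-.
  rewrite set_itvco0 integral_set0 subr0 fineK//.
  exact: integral_itv_fin iT mk k0 (aT n) Tt (atn n).
have /cvg_lim <- // := cvg_integral_itv0 mk k0 Tt.
apply/cvg_lim => //; under eq_fun do rewrite intE.
apply: cvg_EFin; first by near=> n.
rewrite -[X in _ --> X]subr0; apply: cvgB; first exact: cvg_cst.
apply: cvg_comp A0.
have a0 : t / n.+2%:R @[n --> \oo] --> (0 : R).
  rewrite -(mulr0 t); apply: cvgMr.
  by have := @cvg_harmonic R; rewrite -(cvg_shiftS (@harmonic R)).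
move=> P /= P0; have /a0 : nbhs (0 : R) [set e | 0 < e -> P e] by exact: P0.
rewrite !near_simpl => cP; near=> n.
have : 0 < t / n.+2%:R -> P (t / n.+2%:R) by near: n.
by apply; rewrite divr_gt0.
Unshelve. all: by end_near. Qed.

Lemma bracketed_integral T k : (0 < T)%E -> monotone_on (itv0 T) k ->
  (forall x, itv0 T x -> 0 <= k x) ->
  (forall t, itv0 T t -> (\int[mu]_(x in `]0%R, t[) (k x)%:E < +oo)%E) ->
  exists2 A, bracketed (itv0 T) k A & A a @[a --> 0^'+] --> (0 : R).
Proof.
move=> T0 mk k0 kfin; have iT := @is_interval_itv0 _ T.
pose A t := fine (\int[mu]_(x in `]0%R, t[) (k x)%:E)%E.
have intE t : itv0 T t -> (\int[mu]_(x in `]0%R, t[) (k x)%:E = (A t)%:E)%E.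
  move=> Tt; rewrite /A fineK// ge0_fin_numE ?kfin//.
  apply: integral_ge0 => x /=; rewrite in_itv/= => /andP[x0 xt].
  by rewrite lee_fin k0//; exact: itv0_le Tt x0 (ltW xt).
have AB a b : itv0 T a -> itv0 T b -> a <= b ->
    ((A b - A a)%:E = \int[mu]_(x in `[a, b[) (k x)%:E)%E.
  move=> Ta Tb ab; have [a0 _] := Ta.
  have bT : `]0, b[ `<=` itv0 T.
    by move=> x /=; rewrite in_itv/= => /andP[x0 /ltW xb]; exact: itv0_le Tb x0 xb.
  have := intE _ Tb; rewrite (@ge0_integral_itv_catl (BRight 0) k a b)//; last 2 first.
  - exact: monotone_measurable bT.
  - by move=> x /bT /k0.
  by rewrite EFinB (intE _ Ta) => <-; rewrite addeAC subee// add0e.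
exists A.
  move=> a b Ta Tb ab; rewrite -!lee_fin AB//.
  exact: integral_itv_bracket iT mk k0 Ta Tb ab.
apply/cvgrPdist_lt => eps eps0.
have [t Tt] := itv0_nonempty T0; have [t0 _] := Tt.
have atn n : t / n.+2%:R <= t.
  by rewrite ler_pdivrMr// ler_peMr ?(ltW t0)// ler1n.
have a0 n : 0 < t / n.+2%:R by rewrite divr_gt0.
have aT n : itv0 T (t / n.+2%:R) by exact: itv0_le Tt (a0 n) (atn n).
have A_ge0 a : itv0 T a -> 0 <= A a.
  move=> Ta; rewrite /A fine_ge0// integral_ge0// => x /=.
  rewrite in_itv/= => /andP[x0 xa].
  by rewrite lee_fin k0//; exact: itv0_le Ta x0 (ltW xa).
(* This limit provides an n for which A is smaller than [eps] at t / (n + 2); being non-negative and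
   non-decreasing, A is then smaller than [eps] at all earlier times. *)
have : ((A t - A (t / n.+2%:R))%:E @[n --> \oo] --> (A t)%:E)%E.
  under eq_fun do rewrite AB//.
  by rewrite -intE//; exact: cvg_integral_itv0 Tt.
move=> /fine_cvg/cvgrPdist_lt/(_ _ eps0)[n _ /(_ n (leqnn n))].
rewrite /= opprB addrC subrK => An.
near=> a; have a_gt0 : 0 < a by [].
have an : a <= t / n.+2%:R by near: a; exact: nbhs_right_le.
have Ta := itv0_le (aT n) a_gt0 an.
rewrite sub0r normrN ger0_norm ?A_ge0//; apply: le_lt_trans An.
rewrite ger0_norm ?A_ge0// -subr_ge0 -lee_fin AB//.
apply: integral_ge0 => x /=; rewrite in_itv/= => /andP[ax xt].
by rewrite lee_fin k0//; exact: itv0_le (aT n) (lt_le_trans a_gt0 ax) (ltW xt).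
Unshelve. all: by end_near. Qed.

End bracketed_integral.

(** * Changes of time *)

Section bracketed_regularity.
Context {R : realType}.
Implicit Types (D : set R) (k A : R -> R) (a b t : R) (T : \bar R).

Lemma bracketed_lt D k A a b : bracketed D k A -> (forall x, D x -> 0 < k x) ->
  D a -> D b -> a < b -> A a < A b.
Proof.
move=> bA k0 Da Db ab; have /andP[+ _] := bA _ _ Da Db (ltW ab).
by rewrite -subr_gt0; apply: lt_le_trans; rewrite mulr_gt0 ?subr_gt0// lt_min !k0.
Qed.

Lemma bracketed_le D k A a b : bracketed D k A -> (forall x, D x -> 0 < k x) ->
  D a -> D b -> a <= b -> A a <= A b.
Proof.
move=> bA k0 Da Db; rewrite le_eqVlt => /predU1P[->//|ab].
exact/ltW/(bracketed_lt bA k0).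
Qed.

(** Around t, A is Lipschitz with constant the larger of the values of k at t / 2 and at some later
    time [t2]; monotonicity bounds k by it in between. *)
Lemma bracketed_continuous T k A t : monotone_on (itv0 T) k ->
  (forall x, itv0 T x -> 0 < k x) -> bracketed (itv0 T) k A ->
  itv0 T t -> {for t, continuous A}.
Proof.
move=> mk k0 bA Tt; have [t2 tt2 Tt2] := itv0_next Tt.
have [t_gt0 _] := Tt.
have Tt1 : itv0 T (t / 2) by apply: itv0_le Tt _ _; lra.
have t2t : t / 2 < t by lra.
pose M := Num.max (k (t / 2)) (k t2).
have M0 : 0 < M by rewrite lt_max k0.
have k_le x : itv0 T x -> t / 2 <= x <= t2 -> k x <= M.
  move=> Tx /andP[tx xt]; rewrite le_max.
  by case: mk => mk; [rewrite (mk x t2) ?orbT|rewrite (mk (t / 2) x)].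
have lip x : t / 2 <= x <= t2 -> `|A t - A x| <= `|t - x| * M.
  move=> xt; have Tx : itv0 T x.
    by move: xt => /andP[? ?]; apply: itv0_le Tt2 _ _ => //; lra.
  have kM : Num.max (k x) (k t) <= M by rewrite ge_max !k_le//; lra.
  have [tx|/ltW xt'] := leP t x.
    have /andP[_] := bA _ _ Tt Tx tx.
    have := bracketed_le bA k0 Tt Tx tx.
    rewrite maxC => Atx /le_trans/(_ (ler_wpM2l _ kM)); rewrite subr_ge0 => /(_ tx).
    by rewrite distrC ger0_norm ?subr_ge0// distrC ger0_norm ?subr_ge0.
  have /andP[_] := bA _ _ Tx Tt xt'.
  have := bracketed_le bA k0 Tx Tt xt'.
  move=> Axt /le_trans/(_ (ler_wpM2l _ kM)); rewrite subr_ge0 => /(_ xt').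
  by rewrite ger0_norm ?subr_ge0// ger0_norm ?subr_ge0.
apply/cvgrPdist_lt => eps eps0; near=> x.
apply: (@le_lt_trans _ _ (`|t - x| * M)).
  apply: lip; apply/andP; split; near: x.
    by apply: filterS (lt_nbhsr t2t) => x /ltW.
  by apply: filterS (lt_nbhsl tt2) => x /ltW.
rewrite -ltr_pdivlMr//; near: x; apply: cvgr_dist_lt; first exact: cvg_id.
by rewrite divr_gt0.
Unshelve. all: by end_near. Qed.

Lemma bracketed_right_derivative T k A t : bracketed (itv0 T) k A ->
  itv0 T t -> k u @[u --> t^'+] --> k t ->
  (A (t + e) - A t) / e @[e --> 0^'+] --> k t.
Proof.
move=> bA Tt kt; have [t2 tt2 Tt2] := itv0_next Tt; have [t0 _] := Tt.
apply/cvgrPdist_le => eps eps0.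
move/cvgrPdist_le/(_ _ eps0)/nbhs_right0P : kt => kt.
near=> e; have e0 : 0 < e by [].
have te : e <= t2 - t by near: e; apply: nbhs_right_le; rewrite subr_gt0.
have Tte : itv0 T (t + e) by apply: itv0_le Tt2 _ _; lra.
have kte : `|k t - k (t + e)| <= eps by near: e.
apply: le_trans kte.
have /andP[lo hi] : (t + e - t) * Num.min (k t) (k (t + e)) <= A (t + e) - A t <=
    (t + e - t) * Num.max (k t) (k (t + e)) by apply: bA => //; lra.
have teE : t + e - t = e by rewrite addrAC subrr add0r.
rewrite teE in lo hi.
have {}lo : Num.min (k t) (k (t + e)) <= (A (t + e) - A t) / e.
  by rewrite ler_pdivlMr// mulrC.
have {}hi : (A (t + e) - A t) / e <= Num.max (k t) (k (t + e)).
  by rewrite ler_pdivrMr// mulrC.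
move: lo hi; case: (leP (k t) (k (t + e))) => [kk|/ltW kk] kq qk.
  by rewrite ![`|k t - _|]distrC !ger0_norm ?subr_ge0 ?lerD2r.
by rewrite !ger0_norm ?subr_ge0 ?lerD2l ?lerN2.
Unshelve. all: by end_near. Qed.

End bracketed_regularity.

Section along.
Context {R : realType} {X : metricType R}.
Implicit Types (y z : curve R X) (t s : R).

Definition itv0_sub (T : \bar R) t (Tt : itv0 T t) : itv0 T :=
  SigSub (mem_set Tt).

Lemma valL_sub (V : Type) (v : V) (D : set R) (g : D -> V) (x : D) :
  'valL_v g (\val x) = g x.
Proof. by rewrite /valL_/= oinv_set_val valK. Qed.

Lemma along_sub (V : nmodType) (u : X -> V) y (t : itv0 (dur y)) :
  along u y (\val t) = u (y t).
Proof. exact: valL_sub. Qed.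

Lemma along_itv0 (V : nmodType) (u : X -> V) y t (Tt : itv0 (dur y) t) :
  along u y t = u (y (itv0_sub Tt)).
Proof. exact: (along_sub u (itv0_sub Tt)). Qed.

Lemma itv0_val (T : \bar R) (t : itv0 T) : itv0 T (\val t).
Proof. exact: set_valP. Qed.

(** The domain type depends on the duration, so values are compared at points with the same
    underlying real number. *)
Lemma eq_curve y z (T T' : \bar R) (g : itv0 T -> X) (g' : itv0 T' -> X) :
  T = T' -> (forall u u', \val u = \val u' -> g u = g' u') ->
  Curve T g = Curve T' g'.
Proof.
move=> TT'; case: _ / TT' g' => g' gg'; congr Curve.
by apply/funext => t; exact: gg'.
Qed.

End along.

Section time_change.
Context {R : realType} {X : metricType R}.
Implicit Types (k : X -> R) (y z : curve R X) (A B : R -> R).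

(** States that z = y o B, where B is the inverse of a primitive A of the rate k along y, vanishing
    at 0. A and B are total functions with arbitrary values outside the two time intervals. A enters
    through [bracketed] and not as an integral, which keeps the relation symmetric. *)
Record time_change k y z A B : Prop := TimeChange {
  tc_dur : (0 < dur y)%E ;
  tc_dur' : (0 < dur z)%E ;
  tc_gt0 : forall t, itv0 (dur y) t -> 0 < along k y t ;
  tc_mono : monotone_on (itv0 (dur y)) (along k y) ;
  tc_bracketed : bracketed (itv0 (dur y)) (along k y) A ;
  tc_cvg0 : A a @[a --> 0^'+] --> (0 : R) ;
  tc_itv0 : forall t, itv0 (dur y) t -> itv0 (dur z) (A t) ;
  tc_itv0' : forall s, itv0 (dur z) s -> itv0 (dur y) (B s) ;
  tcK : forall t, itv0 (dur y) t -> B (A t) = t ;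
  tcK' : forall s, itv0 (dur z) s -> A (B s) = s ;
  tc_path : forall (t : itv0 (dur y)) (s : itv0 (dur z)),
    \val s = A (\val t) -> z s = y t }.

Lemma tc_along k y z A B (V : nmodType) (u : X -> V) s :
  time_change k y z A B -> itv0 (dur z) s -> along u z s = along u y (B s).
Proof.
move=> tc zs; have yBs := tc_itv0' tc zs.
rewrite (along_itv0 u zs) (along_itv0 u yBs); congr u.
by apply: (tc_path tc) => /=; rewrite (tcK' tc).
Qed.

Lemma tc_lt k y z A B s s' : time_change k y z A B ->
  itv0 (dur z) s -> itv0 (dur z) s' -> s < s' -> B s < B s'.
Proof.
move=> tc zs zs' ss'; rewrite ltNge; apply/negP => Bs.
have := bracketed_le (tc_bracketed tc) (tc_gt0 tc) (tc_itv0' tc zs') (tc_itv0' tc zs) Bs.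
by rewrite !(tcK' tc)// leNgt ss'.
Qed.

Lemma tc_le k y z A B s s' : time_change k y z A B ->
  itv0 (dur z) s -> itv0 (dur z) s' -> s <= s' -> B s <= B s'.
Proof.
move=> tc zs zs'; rewrite le_eqVlt => /predU1P[->//|ss'].
exact/ltW/(tc_lt tc).
Qed.

(** The bracket of A between [B a] and [B b] bounds b - a by [B b - B a] times the extreme rates;
    dividing by these rates gives the bracket of B with rate 1 / k. *)
Lemma time_change_sym k y z A B :
  time_change k y z A B -> time_change (fun p => (k p)^-1) z y B A.
Proof.
move=> tc.
have kE s : itv0 (dur z) s -> along (fun p => (k p)^-1) z s = (along k y (B s))^-1.
  by move=> zs; rewrite (tc_along _ tc zs) !(along_itv0 _ (tc_itv0' tc zs)).
have kB_gt0 s : itv0 (dur z) s -> 0 < along k y (B s).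
  by move=> zs; exact: (tc_gt0 tc (tc_itv0' tc zs)).
split; first exact: tc_dur' tc.
- exact: tc_dur tc.
- by move=> s zs; rewrite kE// invr_gt0 kB_gt0.
- case: (tc_mono tc) => mk; [right|left] => a b za zb ab.
    rewrite !kE// lef_pV2 ?posrE ?kB_gt0//.
    exact: mk (tc_itv0' tc za) (tc_itv0' tc zb) (tc_le tc za zb ab).
  rewrite !kE// lef_pV2 ?posrE ?kB_gt0//.
  exact: mk (tc_itv0' tc za) (tc_itv0' tc zb) (tc_le tc za zb ab).
- move=> a b za zb ab.
  have := tc_bracketed tc (tc_itv0' tc za) (tc_itv0' tc zb) (tc_le tc za zb ab).
  rewrite !(tcK' tc)// !kE//.
  have ka := kB_gt0 a za; have kb := kB_gt0 b zb.
  set u := along k y (B a) in ka *; set v := along k y (B b) in kb *.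
  have [uv|/ltW uv] := leP u v.
    rewrite min_r ?max_l ?lef_pV2 ?posrE// => /andP[h1 h2].
    by rewrite ler_pdivrMr// ler_pdivlMr// h1 h2.
  rewrite min_l ?max_r ?lef_pV2 ?posrE// => /andP[h1 h2].
  by rewrite ler_pdivrMr// ler_pdivlMr// h1 h2.
(* For a time r of y with r <= eps / 2, every s <= [A r] satisfies [B s] <= r < eps. *)
- apply/cvgrPdist_lt => eps eps0.
  have [t yt] := itv0_nonempty (tc_dur tc); have [t0 _] := yt.
  have yr : itv0 (dur y) (Num.min t (eps / 2)).
    by apply: itv0_le yt _ _; rewrite ?lt_min ?t0 ?divr_gt0// ge_min lexx.
  set r := Num.min _ _ in yr; have zAr := tc_itv0 tc yr.
  have [Ar0 _] := zAr.
  near=> s; have s0 : 0 < s by [].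
  have sAr : s <= A r by near: s; exact: nbhs_right_le.
  have zs := itv0_le zAr s0 sAr.
  rewrite sub0r normrN ger0_norm; last by case: (tc_itv0' tc zs) => /ltW.
  rewrite (le_lt_trans (tc_le tc zs zAr sAr))// (tcK tc)//.
  by rewrite gt_min; apply/orP; right; lra.
- exact: tc_itv0' tc.
- exact: tc_itv0 tc.
- exact: tcK' tc.
- exact: tcK tc.
- by move=> s t tE; apply/esym/(tc_path tc); rewrite tE (tcK' tc)//; exact: itv0_val.
Unshelve. all: by end_near. Qed.

Lemma tc_integral k y z A B t : time_change k y z A B -> itv0 (dur y) t ->
  (\int[lebesgue_measure]_(x in `]0%R, t[) (along k y x)%:E = (A t)%:E)%E.
Proof.
move=> tc yt; apply: integral_bracketed_eq (tc_mono tc) _ _ (tc_cvg0 tc) yt.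
  by move=> x yx; exact/ltW/(tc_gt0 tc).
exact: tc_bracketed tc.
Qed.

Lemma ereal_sup_tc k y z A B : time_change k y z A B ->
  ereal_sup [set (A t)%:E | t in itv0 (dur y)] = dur z.
Proof.
move=> tc; rewrite -[RHS](ereal_sup_itv0 (tc_dur' tc)); congr ereal_sup.
apply/seteqP; split => _ [t yt <-]; first by exists (A t) => //; exact: tc_itv0 tc _ yt.
by exists (B t); [exact: tc_itv0' tc _ yt|rewrite (tcK' tc)].
Qed.

End time_change.

(** * Computation of [reparam] and existence of time changes *)

Section reparametrization.
Context {R : realType} {X : metricType R}.
Implicit Types (k : X -> R) (y z : curve R X) (A B : R -> R) (T : \bar R).

#[local] Instance left_nbhs_filter T : ProperFilter (left_nbhs T).
Proof.
case: T => [r||].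
- exact: at_left_proper_filter.
- exact: proper_pinfty_nbhs.
- exact: proper_ninfty_nbhs.
Qed.

Lemma near_left_nbhs T t : itv0 T t ->
  \forall u \near left_nbhs T, t < u /\ itv0 T u.
Proof.
move=> [t0]; case: T => [r||] /=; last by rewrite ltNge leNye.
  rewrite lte_fin => tr; near=> u.
  have tu : t < u by near: u; exact: nbhs_left_gt.
  by split => //; split; [exact: lt_trans t0 tu|rewrite lte_fin].
move=> _; near=> u.
have tu : t < u by near: u; apply: nbhs_pinfty_gt; rewrite num_real.
by split => //; split; [exact: lt_trans t0 tu|exact: ltry].
Unshelve. all: by end_near. Qed.

(** A is increasing and its values fill ]0, [dur z][, so it eventually exceeds each v < [dur z].
    This identifies the duration that [reparam] defines as a limit. *)
Lemma tc_cvg_left k y z A B : time_change k y z A B ->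
  ((A t)%:E @[t --> left_nbhs (dur y)] --> dur z)%E.
Proof.
move=> tc.
have [t0 yt0] := itv0_nonempty (tc_dur tc).
have gt_dur (v : R) : (v%:E < dur z)%E ->
    \forall u \near left_nbhs (dur y), itv0 (dur y) u /\ v < A u.
  rewrite -{1}(ereal_sup_tc tc) => /ereal_sup_gt[_ [t yt <-]]; rewrite lte_fin => vt.
  apply: filterS (near_left_nbhs yt) => u [tu yu]; split => //.
  by rewrite (lt_trans vt)// (bracketed_lt (tc_bracketed tc) (tc_gt0 tc)).
case zE : (dur z) => [r||].
- apply: cvg_EFin; first by near=> u.
  apply/cvgrPdist_lt => eps eps0.
  have : ((r - eps)%:E < dur z)%E by rewrite zE lte_fin ltrBlDr ltrDl.
  move/gt_dur; apply: filterS => u [yu reps].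
  have : A u < r by rewrite -lte_fin -zE; case: (tc_itv0 tc yu).
  by move=> ur; rewrite gtr0_norm ?subr_gt0// ltrBlDl -ltrBlDr.
- apply/cvgeyPgt => v.
  have : (v%:E < dur z)%E by rewrite zE ltry.
  by move/gt_dur; apply: filterS => u [_]; rewrite lte_fin.
- by have := tc_dur' tc; rewrite zE.
Unshelve. all: by end_near. Qed.

(** B supplies the preimages, so [reparam] takes its first branch; whichever preimage [cid] selects,
    [tc_path] gives the same point of the curve. *)
Lemma tc_reparam k y z A B (a : R -> \bar R) : time_change k y z A B ->
  (forall t, itv0 (dur y) t -> a t = (A t)%:E) -> reparam a y = z.
Proof.
move=> tc aA.
have [t0 yt0] := itv0_nonempty (tc_dur tc).
have limE : lim (a t @[t --> left_nbhs (dur y)]) = dur z.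
  apply/cvg_lim => //; apply: cvg_trans (tc_cvg_left tc); apply: near_eq_cvg.
  by apply: filterS (near_left_nbhs yt0) => u [_ /aA].
rewrite /reparam; case: pselect => [a_onto|[]]; last first.
  rewrite limE => s; have yBs := tc_itv0' tc (itv0_val s).
  exists (itv0_sub yBs); rewrite aA//= (tcK' tc)//; exact: itv0_val.
case: z limE tc => T' z' /= limE tc.
apply: eq_curve => // s s' ss'; case: cid => t /= atE.
apply/esym/(tc_path tc); rewrite -ss'; apply: EFin_inj.
by rewrite -atE aA//; exact: itv0_val.
Qed.

(** Finiteness of the integrals near 0 yields A. The duration of z is the supremum of A, so that A
    is onto by the intermediate value theorem, and B is a choice of preimages. *)
Lemma exists_time_change k y : (0 < dur y)%E ->
  (forall t, itv0 (dur y) t -> 0 < along k y t) ->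
  monotone_on (itv0 (dur y)) (along k y) ->
  (forall t, itv0 (dur y) t ->
    (\int[lebesgue_measure]_(x in `]0%R, t[) (along k y x)%:E < +oo)%E) ->
  exists z A B, time_change k y z A B.
Proof.
move=> y0 k0 mk kfin.
have [A bA A0] := bracketed_integral y0 mk (fun t yt => ltW (k0 t yt)) kfin.
have A_lt a b : itv0 (dur y) a -> itv0 (dur y) b -> a < b -> A a < A b.
  exact: bracketed_lt bA k0.
have [t0 yt0] := itv0_nonempty y0.
have A_near0 eps t : 0 < eps -> itv0 (dur y) t ->
    exists t', [/\ itv0 (dur y) t', t' < t & `|A t'| < eps].
  move=> eps0 yt; have [t_gt0 _] := yt.
  have A0eps : \forall a \near 0^'+, `|A a| < eps by exact: cvgr0_norm_lt A0 _ eps0.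
  near (0 : R)^'+ => a; have a0 : 0 < a by [].
  have lt_at : a < t by near: a; exact: nbhs_right_lt.
  exists a; split=> //; first exact: itv0_le yt a0 (ltW lt_at).
  by near: a.
(* If A t <= 0, then A is negative at an earlier [t1] and stays below [A t1] before it, against the
   limit 0 at 0. *)
have A_gt0 t : itv0 (dur y) t -> 0 < A t.
  move=> yt; rewrite ltNge; apply/negP => At.
  have [t1 [yt1 t1t _]] := A_near0 1 t ltr01 yt.
  have At1 : A t1 < 0 by exact: lt_le_trans (A_lt _ _ yt1 yt t1t) At.
  have [|t2 [yt2 t2t1]] := A_near0 (- A t1) t1 _ yt1; first by rewrite oppr_gt0.
  by rewrite ltr_norml opprK => /andP[]; have := A_lt _ _ yt2 yt1 t2t1; lra.
pose T' := ereal_sup [set (A t)%:E | t in itv0 (dur y)].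
have AT' t : itv0 (dur y) t -> itv0 T' (A t).
  move=> yt; split; first exact: A_gt0.
  have [t' tt' yt'] := itv0_next yt.
  apply: (@lt_le_trans _ _ (A t')%:E); first by rewrite lte_fin A_lt.
  by apply: ereal_sup_ubound; exists t'.
(* The implication stands under the existential so that [choice] returns a total function; the value
   0 outside ]0, T'[ is arbitrary. *)
have A_onto s : exists t, itv0 T' s -> itv0 (dur y) t /\ A t = s.
  have [T's|] := pselect (itv0 T' s); last by exists 0.
  have [s0 /ereal_sup_gt[_ [t yt <-]]] := T's; rewrite lte_fin => st.
  have [t' [yt' tt' At']] := A_near0 s t s0 yt.
  have itv_sub : `[t', t]%classic `<=` itv0 (dur y).
    move=> x /=; rewrite in_itv/= => /andP[t'x xt].
    by apply: is_interval_itv0 yt' yt _ _; rewrite t'x.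
  have cA : {within `[t', t], continuous A}.
    apply: continuous_in_subspaceT => x /[!inE] /itv_sub yx.
    exact: bracketed_continuous mk k0 bA yx.
  have [|r] := IVT (v := s) (ltW tt') cA.
    rewrite min_l ?max_r ?(ltW (A_lt _ _ yt' yt tt'))// (ltW st) andbT ltW//.
    exact: le_lt_trans (ler_norm _) At'.
  by move=> /itv_sub yr Ar; exists r.
have [B AB] := choice A_onto.
have yB s : itv0 T' s -> itv0 (dur y) (B s) by case/AB.
exists (Curve T' (fun s => y (itv0_sub (yB _ (itv0_val s))))), A, B.
have A_inj a b : itv0 (dur y) a -> itv0 (dur y) b -> A a = A b -> a = b.
  move=> ya yb Aab; have [ab|ba|//] := ltgtP a b.
    by have := A_lt _ _ ya yb ab; rewrite Aab ltxx.
  by have := A_lt _ _ yb ya ba; rewrite Aab ltxx.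
split => //=.
- by have [A0' AT0] := AT' _ yt0; apply: lt_trans AT0; rewrite lte_fin.
- by move=> t yt; have [yBA ABA] := AB _ (AT' _ yt); exact: A_inj.
- by move=> s /AB[].
- move=> t s sE; congr (y _); apply: val_inj => /=.
  have [yBs ABs] := AB _ (itv0_val s); apply: A_inj => //; first exact: itv0_val.
  by rewrite ABs.
Unshelve. all: by end_near. Qed.

End reparametrization.

(** * Monotonicity and right continuity along curves *)

Section curves.
Context {R : realType} {X : metricType R}.
Implicit Types (f : X -> \bar R) (k : X -> R) (y z : curve R X) (A B : R -> R).

Lemma mdist_continuous (x : X) : continuous (fun p : X => mdist p x).
Proof.
move=> p; apply/cvgrPdist_lt => eps eps0.
have : \forall q \near p, mdist p q < eps.
  by apply: (metricType_numDomainType.cvgr_dist_lt _ eps0); exact: cvg_id.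
apply: filterS => q; apply: le_lt_trans.
have := metric_triangle p q x; have := metric_triangle q p x.
by rewrite (metric_sym q p) ler_norml => h1 h2; apply/andP; split; lra.
Qed.

(** The normalisation of EVI_0; the function differentiated in EVI_{0,N} is half of it. *)
Definition half_sqr_mdist (x p : X) : R := mdist p x ^+ 2 / 2.

Lemma half_sqr_mdist_continuous (x : X) : continuous (half_sqr_mdist x).
Proof.
move=> p; apply: cvgM; last exact: cvg_cst.
by rewrite expr2; apply: cvgM; exact: mdist_continuous.
Qed.

Lemma path_continuousP y (x0 : X) : continuous (y : itv0 (dur y) -> X) <->
  forall t, itv0 (dur y) t -> {for t, continuous ('valL_x0 y)}.
Proof.
rewrite -(subspace_valL_continuousP' (itv0 (dur y)) x0).
rewrite (continuous_open_subspace _ (@open_itv0 _ (dur y))).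
split=> [cy t yt|cy t]; first by apply: cy; rewrite inE.
by rewrite inE; exact: cy.
Qed.

Lemma along_continuous y (u : X -> R) t :
  continuous (y : itv0 (dur y) -> X) -> continuous u -> itv0 (dur y) t ->
  {for t, continuous (along u y)}.
Proof.
move=> cy cu yt.
have : continuous (fun r : itv0 (dur y) => u (y r)).
  by move=> r; apply: (@continuous_comp _ _ _ y u r); [exact: cy|exact: cu].
rewrite -(subspace_valL_continuousP' (itv0 (dur y)) (0 : R)).
by rewrite (continuous_open_subspace _ (@open_itv0 _ (dur y))); apply; rewrite inE.
Qed.

Lemma along_comp (V W : nmodType) (u : X -> V) (phi : V -> W) y t :
  itv0 (dur y) t -> along (fun p => phi (u p)) y t = phi (along u y t).
Proof. by move=> yt; rewrite !(along_itv0 _ yt). Qed.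

Lemma lsc_near_path f y t (a : R) : lower_semicontinuous f ->
  continuous (y : itv0 (dur y) -> X) -> (a%:E < f (y t))%E ->
  \forall r \near (\val t : R),
    forall yr : itv0 (dur y) r, (a%:E < f (y (itv0_sub yr)))%E.
Proof.
move=> lf cy /lf[V yV aV].
have yt := itv0_val t.
have : \forall r \near (\val t : R), V ('valL_(y t) y r).
  by apply: ((path_continuousP y (y t)).1 cy _ yt); rewrite valL_sub.
apply: filterS => r Vr yr; apply: aV.
by move: Vr; rewrite -[r]/(\val (itv0_sub yr)) valL_sub.
Qed.

(* If [f (y s) < f (y t)] for some [s <= t], take the last time [s1] before [t]
   at which [f \o y] is at most [f (y s)]: testing with [x = y s1] shows that the
   distance to [y s1] does not increase on [s1, t], so that [y t = y s1]. *)
Lemma C1_of_dini f y : lower_semicontinuous f -> curve_in (edom f) y ->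
  (forall s t : itv0 (dur y), (f (y s) <= f (y t))%E ->
    (dini_upper_right (along (half_sqr_mdist (y s)) y) (\val t) <= 0)%E) ->
  C1 f y.
Proof.
move=> lf cy dy; split=> // s t st; have [_ y_cont y_edom] := cy.
rewrite leNgt; apply/negP => fst.
pose a := fine (f (y s)).
have aE : f (y s) = a%:E by rewrite /a fineK//; exact: y_edom.
have [s0 _] := itv0_val s; have yt := itv0_val t.
pose S := [set r | \val s <= r <= \val t /\
  exists yr : itv0 (dur y) r, (f (y (itv0_sub yr)) <= f (y s))%E].
have Ss : S (\val s).
  split; first by rewrite lexx st.
  exists (itv0_val s); rewrite (_ : itv0_sub _ = s)//; exact: val_inj.
have supS : has_sup S.
  by split; [exists (\val s)|exists (\val t) => r [/andP[]]].
pose s1 := sup S.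
have ss1 : \val s <= s1 by apply: ub_le_sup Ss; case: supS.
have s1t : s1 <= \val t by apply: ge_sup; [exists (\val s)|move=> r [/andP[]]].
have ys1 : itv0 (dur y) s1 by apply: itv0_le yt _ s1t; exact: lt_le_trans ss1.
have [s1_0 _] := ys1; pose t1 := itv0_sub ys1.
(* The supremum is attained: otherwise lower semicontinuity would keep f o y above f (y s) on a
   neighbourhood of s1, which contains points of [S]. *)
have ft1 : (f (y t1) <= f (y s))%E.
  rewrite leNgt; apply/negP; rewrite aE => /(lsc_near_path lf y_cont).
  move=> /nbhs_ballP[eps /= eps0] near_s1.
  have [r Sr s1r] := sup_adherent eps0 supS.
  have [_ [yr]] := Sr; rewrite leNgt => /negP; apply; rewrite aE.
  apply: near_s1; have rs1 : r <= s1 by apply: ub_le_sup Sr; case: supS.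
  by rewrite /ball/= ger0_norm ?subr_ge0// ltrBlDr -ltrBlDl.
have : along (half_sqr_mdist (y t1)) y (\val t) <=
       along (half_sqr_mdist (y t1)) y (\val t1).
  apply: dini_upper_right_le0_noninc => //.
    apply: continuous_in_subspaceT => r /[!inE]/=; rewrite in_itv/= => /andP[s1r rt].
    apply: along_continuous y_cont (half_sqr_mdist_continuous (x := _)) _.
    by apply: itv0_le yt _ rt; exact: lt_le_trans s1_0 s1r.
  move=> r /andP[s1r rt].
  have yr : itv0 (dur y) r.
    by apply: itv0_le yt _ (ltW rt); exact: lt_le_trans s1_0 s1r.
  apply: (dy t1 (itv0_sub yr)).
  (* To apply [dy], f (y s1) <= f (y r) is needed: trivial at r = s1, and for r > s1 a consequence
     of r not being in [S]. *)
  move: s1r; rewrite le_eqVlt => /predU1P[s1r|s1r].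
    by rewrite (_ : itv0_sub yr = t1)//; exact: val_inj.
  apply: (le_trans ft1); rewrite leNgt; apply/negP => fr.
  suff : r <= s1 by rewrite leNgt s1r.
  apply: ub_le_sup; first by case: supS.
  split; first by rewrite (ltW rt) (le_trans ss1 (ltW s1r)).
  by exists yr; exact: ltW.
rewrite !along_sub /half_sqr_mdist mdistxx expr0n mul0r.
rewrite pmulr_lle0 ?invr_gt0// => d0.
have : mdist (y t) (y t1) = 0.
  by apply/eqP; rewrite -sqrf_eq0 eq_le d0 sqr_ge0.
move=> /mdist_positivity yt1; move: fst; rewrite yt1.
by rewrite ltNge ft1.
Qed.

Lemma C1_right_continuous f y t : lower_semicontinuous f -> C1 f y ->
  itv0 (dur y) t ->
  along (fun p => fine (f p)) y r @[r --> t^'+] --> along (fun p => fine (f p)) y t.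
Proof.
move=> lf [[_ y_cont y_edom] fy] yt; have [t2 tt2 yt2] := itv0_next yt.
have [t0 _] := yt.
apply/cvgrPdist_le => eps eps0.
rewrite (along_itv0 _ yt); set a := fine _.
have aE : f (y (itv0_sub yt)) = a%:E by rewrite fineK//; exact: y_edom.
have : ((a - eps)%:E < f (y (itv0_sub yt)))%E.
  by rewrite aE lte_fin ltrBlDr ltrDl.
move=> /(lsc_near_path lf y_cont) near_t.
near=> r; have tr : t < r by near: r; exact: nbhs_right_gt.
have yr : itv0 (dur y) r.
  by apply: itv0_le yt2 (lt_trans t0 tr) _; near: r; exact: nbhs_right_le.
rewrite (along_itv0 _ yr); set b := fine _.
have bE : f (y (itv0_sub yr)) = b%:E by rewrite fineK//; exact: y_edom.
have ba : b <= a by rewrite -lee_fin -bE -aE; apply: fy; exact: ltW.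
rewrite ger0_norm ?subr_ge0// lerBlDr -lerBlDl -lee_fin -bE ltW//.
have : forall yr : itv0 (dur y) r, ((a - eps)%:E < f (y (itv0_sub yr)))%E.
  by near: r; apply: cvg_within; exact: near_t.
exact.
Unshelve. all: by end_near. Qed.

Lemma tc_curve_in k y z A B (E : set X) : time_change k y z A B ->
  curve_in E y -> curve_in E z.
Proof.
move=> tc [y0 y_cont yE].
have zB s : z s = y (itv0_sub (tc_itv0' tc (itv0_val s))).
  by apply: (tc_path tc) => /=; rewrite (tcK' tc)//; exact: itv0_val.
split; [exact: tc_dur' tc| |by move=> s; rewrite zB].
have [t yt] := itv0_nonempty y0; pose x0 := y (itv0_sub yt).
apply/(path_continuousP z x0) => s zs.
have tc' := time_change_sym tc.
have B_cont : {for s, continuous B}.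
  exact: bracketed_continuous (tc_mono tc') (tc_gt0 tc') (tc_bracketed tc') zs.
have valLB r : itv0 (dur z) r -> 'valL_x0 z r = 'valL_x0 y (B r).
  move=> zr; rewrite -[r in LHS]/(\val (itv0_sub zr)) valL_sub zB.
  by rewrite -(valL_sub x0).
have : 'valL_x0 y (B r) @[r --> s] --> 'valL_x0 z s.
  rewrite valLB//; apply: (@continuous_comp _ _ _ B ('valL_x0 y) s B_cont).
  exact: (path_continuousP y x0).1 y_cont _ (tc_itv0' tc zs).
apply: cvg_trans; apply: near_eq_cvg.
apply: filterS (open_nbhs_nbhs (conj (@open_itv0 _ (dur z)) zs)) => r zr.
by rewrite valLB.
Qed.

Lemma tc_C1 k y z A B f : time_change k y z A B -> C1 f y -> C1 f z.
Proof.
move=> tc [cy fy]; split; first exact: tc_curve_in tc cy.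
move=> s t st.
have zB r : z r = y (itv0_sub (tc_itv0' tc (itv0_val r))).
  by apply: (tc_path tc) => /=; rewrite (tcK' tc)//; exact: itv0_val.
by rewrite !zB; apply: fy => /=; apply: (tc_le tc) => //; exact: itv0_val.
Qed.

(** Right continuity of the rate makes it the right derivative of A at t, and y = z o A. The passage
    from y to z is the same lemma applied to [time_change_sym]. *)
Lemma tc_dini k y z A B (u : X -> R) t c : time_change k y z A B ->
  itv0 (dur y) t -> along k y r @[r --> t^'+] --> along k y t ->
  (dini_upper_right (along u z) (A t) <= c%:E)%E ->
  (dini_upper_right (along u y) t <= (along k y t * c)%:E)%E.
Proof.
move=> tc yt kt; have tc' := time_change_sym tc.
have [t2 tt2 yt2] := itv0_next yt; have [t0 _] := yt.
have near_y : \forall e \near 0^'+, itv0 (dur y) (t + e) /\ t < t + e.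
  near=> e; have e0 : 0 < e by [].
  split; last by rewrite ltrDl.
  apply: itv0_le yt2 _ _; first exact: addr_gt0.
  by rewrite -lerBrDl; near: e; apply: nbhs_right_le; rewrite subr_gt0.
apply: dini_upper_right_chain.
- exact: tc_along tc' yt.
- by apply: filterS near_y => e [yte _]; exact: tc_along tc' yte.
- by apply: filterS near_y => e [yte]; exact: tc_lt tc' yt yte.
- exact: bracketed_right_derivative (tc_bracketed tc) yt kt.
- exact/ltW/(tc_gt0 tc).
Unshelve. all: by end_near. Qed.

End curves.

(** * Integrability of monotone rates on the time interval *)

Section clocks.
Context {R : realType} {X : metricType R}.
Implicit Types (k : R -> R) (y z : curve R X) (A B : R -> R) (T : \bar R).
Local Notation mu := (@lebesgue_measure R).

Lemma tc_clock (v : X -> R) y z A B c (h : R -> \bar R) t :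
  time_change v y z A B -> itv0 (dur y) t -> 0 < c ->
  (forall r, itv0 (dur y) r -> h r = (c * along v y r)%:E) ->
  ((c^-1)%:E * \int[mu]_(r in `]0%R, t[) h r = (A t)%:E)%E.
Proof.
move=> tc yt c0 hE.
have t_sub r : `]0, t[%classic r -> itv0 (dur y) r.
  by rewrite /= in_itv/= => /andP[r0 /ltW rt]; exact: itv0_le yt r0 rt.
rewrite (@eq_integral _ _ _ mu _ (fun r => c%:E * (along v y r)%:E)%E); last first.
  by move=> r; rewrite inE => /t_sub/hE ->; rewrite EFinM.
rewrite ge0_integralZl_EFin//; last 3 first.
- by move=> r /t_sub/(tc_gt0 tc)/ltW; rewrite lee_fin.
- by apply/measurable_EFinP; exact: (monotone_measurable (@is_interval_itv0 _ _) (tc_mono tc)).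
- exact: ltW.
rewrite (tc_integral tc yt) -!EFinM mulKf// gt_eqF//.
Qed.

(** Only the behaviour at 0 matters: on [r, t] with r > 0 a monotone k is bounded by its end
    values. *)
Lemma integral_itv0_lty T (m : \bar R) k : monotone_on (itv0 T) k ->
  (forall t, itv0 T t -> 0 <= k t) -> (0 < m <= T)%E ->
  (\int[mu]_(t in itv0 m) (k t)%:E < +oo)%E ->
  forall t, itv0 T t -> (\int[mu]_(r in `]0%R, t[) (k r)%:E < +oo)%E.
Proof.
move=> mk k0 /andP[m0 mT] km t Tt; have iT := @is_interval_itv0 _ T.
have [s ms] := itv0_nonempty m0; have [s0 _] := ms; have [t0 _] := Tt.
pose r := Num.min s t.
have r0 : 0 < r by rewrite lt_min s0.
have mr : itv0 m r by apply: itv0_le ms r0 _; rewrite ge_min lexx.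
have rt : r <= t by rewrite ge_min lexx orbT.
have Tr : itv0 T r := itv0_le Tt r0 rt.
have mT_sub : itv0 m `<=` itv0 T.
  by move=> x [x0 xm]; split => //; exact: lt_le_trans mT.
have t_sub x : x \in `]0, t[ -> itv0 T x.
  by rewrite in_itv/= => /andP[x0 /ltW xt]; exact: itv0_le Tt x0 xt.
rewrite (@ge0_integral_itv_catl _ (BRight 0) k r t)//; last 2 first.
- exact: (monotone_measurable iT mk).
- by move=> x /t_sub/k0.
apply: lte_add_pinfty; last first.
  by rewrite ltey_eq (integral_itv_fin iT mk k0 Tr Tt rt).
apply: le_lt_trans km; apply: ge0_subset_integral => //.
- exact: measurable_itv0.
- by apply/measurable_EFinP; exact: (monotone_measurable iT mk).
- by move=> x /mT_sub/k0; rewrite lee_fin.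
- by move=> x /=; rewrite in_itv/= => /andP[x0 /ltW xr]; exact: itv0_le mr x0 xr.
Qed.

(** Here k has to be non-increasing: when T <= 1 the integral reaches the right end of the domain,
    where k is controlled by its value at an earlier time s. The cut at 1 keeps the measure of the
    remaining set finite. *)
Lemma integral_itv0_min1_lty T k : (0 < T)%E ->
  (forall s t, itv0 T s -> itv0 T t -> s <= t -> k t <= k s) ->
  (forall t, itv0 T t -> 0 <= k t) ->
  (forall t, itv0 T t -> (\int[mu]_(r in `]0%R, t[) (k r)%:E < +oo)%E) ->
  (\int[mu]_(t in itv0 (mine T 1)) (k t)%:E < +oo)%E.
Proof.
move=> T0 k_noninc k0 kfin; set m := mine T 1%E.
have m0 : (0 < m)%E by rewrite lt_min T0 lte01.
have mk : monotone_on (itv0 T) k by right.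
have iT := @is_interval_itv0 _ T.
have mT_sub : itv0 m `<=` itv0 T.
  by move=> x [x0]; rewrite lt_min => /andP[].
have [s ms] := itv0_nonempty m0; have [s0 _] := ms; have Ts := mT_sub _ ms.
pose E := itv0 m `&` `[s, 1]%classic.
have mE : measurable E by apply: measurableI => //; exact: measurable_itv0.
have E_sub : E `<=` itv0 T by move=> x [/mT_sub].
have mEU : itv0 m = `]0, s[%classic `|` E.
  apply/seteqP; split => x.
    move=> mx; have [x0] := mx; rewrite lt_min lte_fin => /andP[_ x1].
    have [xs|sx] := ltP x s; [left|right]; first by rewrite /= in_itv/= x0.
    by split => //=; rewrite in_itv/= sx ltW.
  move=> [/=|[]//]; rewrite in_itv/= => /andP[x0 /ltW xs]; exact: itv0_le ms x0 xs.
have mkm : measurable_fun (itv0 m) (EFin \o k).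
  by apply/measurable_EFinP; exact: (monotone_measurable iT mk).
have k0m x : itv0 m x -> (0 <= (EFin \o k) x)%E.
  by move=> /mT_sub/k0; rewrite lee_fin.
rewrite mEU in mkm k0m *; rewrite ge0_integral_setU//; last first.
  apply/disj_setPS => x [/=]; rewrite in_itv/= => /andP[_ xs] [_ /=].
  by rewrite in_itv/= leNgt xs.
apply: lte_add_pinfty; first exact: kfin.
apply: (@le_lt_trans _ _ (\int[mu]_(x in E) (k s)%:E)%E).
  apply: ge0_le_integral => //.
  - by move=> x /E_sub/k0; rewrite lee_fin.
  - by apply/measurable_EFinP; exact: (monotone_measurable iT mk).
  - move=> x Ex; rewrite lee_fin; apply: k_noninc => //; first exact: E_sub.
    by case: Ex => _ /=; rewrite in_itv/= => /andP[].
rewrite integral_cst//; apply: lte_mul_pinfty; rewrite ?lee_fin ?k0//.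
apply: (@le_lt_trans _ _ (mu `[0, 1]%classic)).
  apply: le_measure; rewrite ?inE//.
  move=> x [_ /=]; rewrite !in_itv/= => /andP[sx ->].
  by rewrite andbT (le_trans (ltW s0)).
by rewrite lebesgue_measure_itv/= lte01 oppr0 adde0 ltry.
Qed.

End clocks.

(** * The clocks of R1 and R2 *)

Section speed.
Context {R : realType} {X : metricType R} (f : X -> \bar R) (N : R).
Context (f_lsc : lower_semicontinuous f) (N_lt0 : N < 0).
Implicit Types (y z : curve R X) (A B : R -> R).

(* [- N / f_N], the right derivative of [clock1] *)
Definition speed (p : X) : R := - N * expR (fine (f p) / N).

Lemma speed_gt0 p : 0 < speed p.
Proof. by rewrite mulr_gt0 ?oppr_gt0 ?expR_gt0. Qed.

Lemma expN_speed p : edom f p -> expN N f p = (- N * (speed p)^-1)%:E.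
Proof.
move=> fp; rewrite (@expN_fin _ _ N f p (fine (f p))) ?fineK//.
rewrite /speed invfM mulrA divff ?oppr_eq0 ?lt_eqF// mul1r.
by rewrite mulNr expRN.
Qed.

Lemma inv_expN_speed p : edom f p -> ((expN N f p)^-1 = (- N^-1 * speed p)%:E)%E.
Proof.
move=> fp; rewrite expN_speed// inver mulf_eq0 oppr_eq0 lt_eqF//= invr_eq0.
by rewrite gt_eqF ?speed_gt0// invfM invrK invrN.
Qed.

Lemma le_speed p q : edom f p -> edom f q -> (f p <= f q)%E -> speed q <= speed p.
Proof.
move=> fp fq fpq; rewrite /speed ler_pM2l ?oppr_gt0// ler_expR.
by rewrite ler_nM2r ?invr_lt0// fine_le.
Qed.

Lemma along_speed_gt0 y t : itv0 (dur y) t -> 0 < along speed y t.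
Proof. by move=> yt; rewrite (along_itv0 _ yt) speed_gt0. Qed.

Lemma C1_along_speed_le y s t : C1 f y -> itv0 (dur y) s -> itv0 (dur y) t ->
  s <= t -> along speed y s <= along speed y t.
Proof.
move=> [[_ _ fy] y_mono] ys yt st; rewrite (along_itv0 _ ys) (along_itv0 _ yt).
by apply: le_speed => //; exact: y_mono.
Qed.

Lemma C1_along_speed_right_cvg y t : C1 f y -> itv0 (dur y) t ->
  along speed y r @[r --> t^'+] --> along speed y t.
Proof.
move=> Cy yt; have [t2 tt2 yt2] := itv0_next yt; have [t0 _] := yt.
pose phi (x : R) := - N * expR (x / N).
have speedE r : itv0 (dur y) r ->
    along speed y r = phi (along (fun p => fine (f p)) y r).
  by move=> yr; rewrite /speed (along_comp _ phi yr).
rewrite speedE//.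
have : phi (along (fun p => fine (f p)) y r) @[r --> t^'+] -->
       phi (along (fun p => fine (f p)) y t).
  apply: cvgMr; apply: continuous_cvg; first exact: continuous_expR.
  by apply: cvgM; [exact: C1_right_continuous|exact: cvg_cst].
apply: cvg_trans; apply: near_eq_cvg; near=> r.
rewrite speedE//; apply: itv0_le yt2 _ _; first by apply: lt_trans t0 _.
by near: r; exact: nbhs_right_le.
Unshelve. all: by end_near. Qed.

Lemma C1_along_inv_speed_right_cvg y t : C1 f y -> itv0 (dur y) t ->
  along (fun p => (speed p)^-1) y r @[r --> t^'+] -->
  along (fun p => (speed p)^-1) y t.
Proof.
move=> Cy yt; have [t2 tt2 yt2] := itv0_next yt; have [t0 _] := yt.
rewrite (along_comp speed (fun x => x^-1) yt).
have : (along speed y r)^-1 @[r --> t^'+] --> (along speed y t)^-1.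
  apply: cvgV; last exact: C1_along_speed_right_cvg.
  by rewrite gt_eqF// along_speed_gt0.
apply: cvg_trans; apply: near_eq_cvg; near=> r.
rewrite (along_comp speed (fun x => x^-1))//.
apply: itv0_le yt2 _ _; first by apply: lt_trans t0 _.
by near: r; exact: nbhs_right_le.
Unshelve. all: by end_near. Qed.

Lemma alongZ (u : X -> R) y a :
  along (fun p => a * u p) y = (fun t => a * along u y t).
Proof.
apply/funext => t; rewrite /along /valL_/=.
by case: ('oinv_set_val t) => //=; rewrite mulr0.
Qed.

(** Meaningful on [edom_star f], and equal to 0 where f = -oo; unlike [speed] it is thus available
    at every test point of the EVI. *)
Definition fN (x : X) : R := fine (expN N f x).

Lemma expN_fN x : edom_star f x -> expN N f x = (fN x)%:E.
Proof. by rewrite -(edom_expN _ N_lt0) => fx; rewrite /fN fineK. Qed.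

(** Doubling the inequality gives both EVI the same left-hand side, and N (1 - f_N (x) / f_N (y_t))
    = N + f_N (x) * (- N / f_N (y_t)). *)
Lemma EVI_0NP y : EVI_0N N f y <-> curve_in (edom f) y /\
  forall x (t : itv0 (dur y)), edom_star f x ->
    (dini_upper_right (along (half_sqr_mdist x) y) (\val t)
      <= (N + fN x * speed (y t))%:E)%E.
Proof.
have rhsE x (t : itv0 (dur y)) : curve_in (edom f) y -> edom_star f x ->
    ((N / 2)%R%:E * (1 - expN N f x / expN N f (y t)) =
     (2^-1 * (N + fN x * speed (y t)))%:E)%E.
  move=> [_ _ fy] fx; rewrite expN_fN// inv_expN_speed//.
  rewrite [LHS](_ : _ = (N / 2 * (1 - fN x * (- N^-1 * speed (y t))))%:E)//.
  congr EFin.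
  by field; rewrite lt_eqF.
have half_sqrE x : half_sqr_mdist x = (fun p => 2 * (mdist p x / 2) ^+ 2).
  by apply/funext => p; rewrite /half_sqr_mdist; field.
have quarter_sqrE x : (fun p => (mdist p x / 2) ^+ 2) =
    (fun p => 2^-1 * half_sqr_mdist x p).
  by apply/funext => p; rewrite /half_sqr_mdist; field.
split=> [[cy dy]|[cy dy]]; split=> // x t fx.
  have := dy x t fx; rewrite rhsE// => /(dini_upper_rightZ (ltr0Sn R 1)).
  by rewrite mulVKf// -alongZ half_sqrE.
have := dy x t fx => /(@dini_upper_rightZ _ _ _ 2^-1)/=.
by rewrite invr_gt0 ltr0n => /(_ isT); rewrite -alongZ -quarter_sqrE rhsE.
Qed.

Lemma EVI_0P z : EVI_0 (expN N f) (edom f) z <-> curve_in (edom f) z /\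
  forall x (s : itv0 (dur z)), edom_star f x ->
    (dini_upper_right (along (half_sqr_mdist x) z) (\val s)
      <= (fN x + N * (speed (z s))^-1)%:E)%E.
Proof.
have rhsE x (s : itv0 (dur z)) : curve_in (edom f) z -> edom_star f x ->
    (expN N f x - expN N f (z s) = (fN x + N * (speed (z s))^-1)%:E)%E.
  move=> [_ _ fz] fx; rewrite expN_fN// expN_speed// -EFinB.
  by rewrite mulNr opprK.
rewrite /EVI_0/= (edom_expN _ N_lt0).
by split=> [[cz dz]|[cz dz]]; split=> // x s fx; have := dz x s fx; rewrite rhsE.
Qed.

Lemma fNE x : edom f x -> fN x = - N * (speed x)^-1.
Proof. by move=> fx; rewrite /fN expN_speed. Qed.

Lemma edom_sub_star x : edom f x -> edom_star f x.
Proof. by rewrite /edom /edom_star /= => fx; rewrite ltey_eq fx. Qed.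

(** For x = y s in the finite domain, the bound is N (1 - speed (y t) / speed x), which is
    non-positive when f x <= f (y t), because [speed] reverses the order of f. *)
Lemma EVI_0N_C1 y : EVI_0N N f y -> C1 f y.
Proof.
move=> /EVI_0NP[cy dy]; apply: C1_of_dini => // s t fst.
have [_ _ fy] := cy.
apply: le_trans (dy _ _ (edom_sub_star (fy s))) _.
rewrite lee_fin fNE// -mulrA mulNr subr_le0.
rewrite -{1}[N]mulr1 ler_nM2l// mulrC ler_pdivrMr ?speed_gt0// mul1r.
exact: le_speed.
Qed.

Lemma tc_EVI y z A B : time_change speed y z A B -> C1 f y ->
  EVI_0N N f y <-> EVI_0 (expN N f) (edom f) z.
Proof.
move=> tc Cy; have tc' := time_change_sym tc; have Cz := tc_C1 tc Cy.
rewrite EVI_0NP EVI_0P; split=> -[cy dy]; (split; [|move=> x t fx]).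
- by case: Cz.
- have zt := itv0_val t.
  pose Bt := itv0_sub (tc_itv0' tc zt).
  have yBt : y Bt = z t.
    by apply/esym/(tc_path tc) => /=; rewrite (tcK' tc).
  have := tc_dini tc' zt (C1_along_inv_speed_right_cvg Cz zt) (dy x Bt fx).
  rewrite along_sub yBt [X in (_ <= X%:E)%E -> _](_ : _ = fN x + N / speed (z t))//.
  by field; rewrite gt_eqF ?speed_gt0.
- by case: Cy.
- have yt := itv0_val t.
  pose At := itv0_sub (tc_itv0 tc yt).
  have zAt : z At = y t by apply: (tc_path tc).
  have := tc_dini tc yt (C1_along_speed_right_cvg Cy yt) (dy x At fx).
  rewrite along_sub zAt [X in (_ <= X%:E)%E -> _](_ : _ = N + fN x * speed (y t))//.
  by field; rewrite gt_eqF ?speed_gt0.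
Qed.

(** Integrability at 0 is automatic: [speed] is non-decreasing along y, hence at most its value at t
    on ]0, t[. *)
Lemma C1_time_change y : C1 f y -> exists z A B, time_change speed y z A B.
Proof.
move=> Cy; have [[y0 _ _] _] := Cy.
have mk : monotone_on (itv0 (dur y)) (along speed y).
  by left => s t ys yt st; exact: C1_along_speed_le.
apply: exists_time_change => //; first exact: along_speed_gt0.
move=> t yt; have [t0 _] := yt.
have t_sub r : `]0, t[%classic r -> itv0 (dur y) r.
  by rewrite /= in_itv/= => /andP[r0 /ltW rt]; exact: itv0_le yt r0 rt.
apply: (@le_lt_trans _ _
    (\int[lebesgue_measure]_(r in `]0%R, t[) (along speed y t)%:E)%E).
  apply: ge0_le_integral => //.
  - by move=> r /t_sub/along_speed_gt0/ltW; rewrite lee_fin.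
  - by apply/measurable_EFinP; exact: (monotone_measurable (@is_interval_itv0 _ _) mk).
  - move=> r tr; rewrite lee_fin; apply: C1_along_speed_le => //; first exact: t_sub.
    by move: tr; rewrite /= in_itv/= => /andP[_ /ltW].
rewrite integral_cst//= lebesgue_measure_itv/= lte_fin t0 -EFinB -EFinM.
exact: ltry.
Qed.

Lemma inv_speedK : (fun p => ((speed p)^-1)^-1) = speed.
Proof. by apply/funext => p; rewrite invrK. Qed.

Lemma along_expN y t : C1 f y -> itv0 (dur y) t ->
  along (expN N f) y t = (- N * along (fun p => (speed p)^-1) y t)%:E.
Proof. by move=> [[_ _ fy] _] yt; rewrite !(along_itv0 _ yt) expN_speed. Qed.

Lemma C1_along_inv_speed_le z s t : C1 f z -> itv0 (dur z) s -> itv0 (dur z) t ->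
  s <= t -> along (fun p => (speed p)^-1) z t <= along (fun p => (speed p)^-1) z s.
Proof.
move=> Cz zs zt st; rewrite !(along_comp speed (fun x => x^-1))//.
by rewrite lef_pV2 ?posrE ?along_speed_gt0// C1_along_speed_le.
Qed.

Lemma along_inv_speed_gt0 z t : itv0 (dur z) t -> 0 < along (fun p => (speed p)^-1) z t.
Proof. by move=> zt; rewrite (along_itv0 _ zt) invr_gt0 speed_gt0. Qed.

Lemma integral_along_expN z (E : set R) : measurable E -> E `<=` itv0 (dur z) ->
  C1 f z -> (\int[lebesgue_measure]_(r in E) along (expN N f) z r =
    (- N)%:E * \int[lebesgue_measure]_(r in E) (along (fun p => (speed p)^-1) z r)%:E)%E.
Proof.
move=> mE Ez Cz; rewrite -ge0_integralZl_EFin//.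
- by apply: eq_integral => r; rewrite inE => /Ez zr; rewrite along_expN.
- by move=> r /Ez zr; rewrite lee_fin ltW// along_inv_speed_gt0.
- apply/measurable_EFinP; apply: (monotone_measurable (@is_interval_itv0 _ (dur z))) => //.
  by right => s t zs zt; exact: C1_along_inv_speed_le.
- by rewrite oppr_ge0 ltW.
Qed.

(** Trades the cut-off at min(T, 1) for all intervals ]0, s[, the form in which [exists_time_change]
    takes integrability. *)
Lemma C2P z : C2 N f z <-> C1 f z /\ forall s, itv0 (dur z) s ->
  (\int[lebesgue_measure]_(r in `]0%R, s[)
    (along (fun p => (speed p)^-1) z r)%:E < +oo)%E.
Proof.
have muly_lty (x : \bar R) : (((- N)%:E * x < +oo) = (x < +oo))%E.
  have N0 : (0 < (- N)%:E)%E by rewrite lte_fin oppr_gt0.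
  case: x => [r||]; rewrite -?EFinM ?ltry//; first by rewrite gt0_muley.
  by rewrite gt0_muleNy.
have min_sub : itv0 (mine (dur z) 1%E) `<=` itv0 (dur z).
  by move=> t [t0]; rewrite lt_min => /andP[].
split=> [[Cz]|[Cz zfin]]; have [[z0 _ _] _] := Cz.
  rewrite integral_along_expN//; last exact: measurable_itv0.
  rewrite muly_lty => zfin; split => //.
  apply: integral_itv0_lty zfin.
  - by right => s t zs zt; exact: C1_along_inv_speed_le.
  - by move=> t /along_inv_speed_gt0/ltW.
  - by rewrite lt_min z0 lte01 ge_min lexx.
split => //; rewrite integral_along_expN//; last exact: measurable_itv0.
rewrite muly_lty; apply: integral_itv0_min1_lty => //.
- by move=> s t zs zt; exact: C1_along_inv_speed_le.
- by move=> t /along_inv_speed_gt0/ltW.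
Qed.

Lemma C2_time_change z : C2 N f z -> exists y A B, time_change speed y z A B.
Proof.
move=> /C2P[Cz zfin]; have [[z0 _ _] _] := Cz.
have [||y [B [A tc]]] := exists_time_change z0 _ _ zfin.
- exact: along_inv_speed_gt0.
- by right => s t zs zt; exact: C1_along_inv_speed_le.
by exists y, A, B; rewrite -inv_speedK; exact: time_change_sym.
Qed.

(** The integral of the inverse rate along z up to s is the original time [B s], a real number; this
    is why [R1] lands in C''_N. *)
Lemma tc_C2 y z A B : time_change speed y z A B -> C1 f y -> C2 N f z.
Proof.
move=> tc Cy; apply/C2P; split; first exact: tc_C1 tc Cy.
by move=> s zs; rewrite (tc_integral (time_change_sym tc) zs) ltry.
Qed.

Lemma tc_C1_inv y z A B : time_change speed y z A B -> C1 f z -> C1 f y.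
Proof. by move=> /time_change_sym; exact: tc_C1. Qed.

Lemma tc_R1 y z A B : time_change speed y z A B -> C1 f y -> R1 N f y = z.
Proof.
move=> tc [[_ _ fy] _]; apply: (tc_reparam tc) => t yt.
rewrite /clock1 -[- N]invrK; apply: (tc_clock tc yt).
  by rewrite invr_gt0 oppr_gt0.
by move=> r yr; rewrite !(along_itv0 _ yr) inv_expN_speed// invrN.
Qed.

Lemma tc_R2 y z A B : time_change speed y z A B -> C1 f y -> R2 N f z = y.
Proof.
move=> tc Cy; have tc' := time_change_sym tc; have Cz := tc_C1 tc Cy.
apply: (tc_reparam tc') => s zs.
rewrite /clock2 -invrN; apply: (tc_clock tc' zs); first by rewrite oppr_gt0.
by move=> r zr; exact: along_expN.
Qed.

End speed.

Unset Implicit Arguments.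

Theorem proposition3p2 (R : realType) (X : metricType R)
    (hX : strictly_intrinsic X) (hXc : geodesic_completion X)
    (f : X -> \bar R) (N : R)
    (f_proper : edom f !=set0) (f_dense : dense (edom f))
    (f_lsc : lower_semicontinuous f) (N_lt0 : N < 0) :
  [/\ R1 N f @` EVI_0N N f = EVI_0 (expN N f) (edom f) `&` C2 N f,
      R2 N f @` (EVI_0 (expN N f) (edom f) `&` C2 N f) = EVI_0N N f,
      set_bij (EVI_0N N f) (EVI_0 (expN N f) (edom f) `&` C2 N f) (R1 N f)
    & set_bij (EVI_0 (expN N f) (edom f) `&` C2 N f) (EVI_0N N f) (R2 N f)].
Proof.
set E1 := EVI_0N N f; set E2 := EVI_0 _ _ `&` _.
(* A single time change computes both maps, [R1] sending y to z and [R2] sending z to y. With the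
   converse [R2P], the four claims are formal. *)
have R1P y : E1 y -> E2 (R1 N f y) /\ R2 N f (R1 N f y) = y.
  move=> Ey; have Cy := EVI_0N_C1 f_lsc N_lt0 Ey.
  have [z [A [B tc]]] := C1_time_change N_lt0 Cy.
  rewrite (tc_R1 N_lt0 tc Cy) (tc_R2 N_lt0 tc Cy); split => //; split.
    exact: (tc_EVI f_lsc N_lt0 tc Cy).1.
  exact: tc_C2 tc Cy.
have R2P z : E2 z -> E1 (R2 N f z) /\ R1 N f (R2 N f z) = z.
  move=> [Ez C2z]; have [y [A [B tc]]] := C2_time_change N_lt0 C2z.
  (* The monotonicity of the energy along z is read off C''_N and carried back to y. *)
  have Cy := tc_C1_inv tc C2z.1.
  rewrite (tc_R2 N_lt0 tc Cy) (tc_R1 N_lt0 tc Cy); split => //.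
  exact: (tc_EVI f_lsc N_lt0 tc Cy).2.
have R1_bij : set_bij E1 E2 (R1 N f).
  split=> [y /R1P[]//|y y' /set_mem/R1P[_ yK] /set_mem/R1P[_ y'K] yy'|z /R2P[Ez zK]].
    by rewrite -yK yy'.
  by exists (R2 N f z).
have R2_bij : set_bij E2 E1 (R2 N f).
  split=> [z /R2P[]//|z z' /set_mem/R2P[_ zK] /set_mem/R2P[_ z'K] zz'|y /R1P[Ey yK]].
    by rewrite -zK zz'.
  by exists (R1 N f y).
split => //; apply/seteqP; split.
- by move=> _ [y Ey <-]; exact: (R1P y Ey).1.
- exact: set_bij_surj R1_bij.
- by move=> _ [z Ez <-]; exact: (R2P z Ez).1.
- exact: set_bij_surj R2_bij.
Qed.
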